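(* Let $K$ be a compact Hausdorff space and let $H$ be a complex Hilbert space. Then the Banach space $C(K,H)$ satisfies the Mazur--Ulam property as a real Banach space; that is, for each real Banach space $Y$ and each surjective isometry $\Delta : S(C(K,H))\to S(Y)$, there exists a surjective real linear isometry from $C(K,H)$ onto $Y$ whose restriction to $S(C(K,H))$ is $\Delta$.
   Context: $C(K,H)$ is the Banach space of all continuous functions from $K$ to $H$, with the supremum norm. For a Banach space $X$, $S(X)$ denotes its unit sphere $\{x\in X:\|x\|=1\}$. An isometry between unit spheres is a map preserving the distances induced by the norms. *)

(* Defs.v *)
From HB Require Import structures.
From mathcomp Require Import all_boot all_order all_algebra.
From mathcomp Require Import sesquilinear complex lra.
From mathcomp Require Import all_classical all_reals.
From mathcomp Require Import topology function_spaces normedtype.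

Set Implicit Arguments.
Unset Strict Implicit.
Unset Printing Implicit Defensive.

Import Order.TTheory GRing.Theory Num.Theory.
Import numFieldNormedType.Exports.

Local Open Scope classical_set_scope.
Local Open Scope ring_scope.
Local Open Scope complex_scope.

Section realnorm.
Variables (R : realType) (H : normedModType R[i]).
Implicit Types x y : H.

(* The norm of an R[i]-normed module takes its values in R[i]; realnorm is the
   same number as an element of R (realnormE). *)
Definition realnorm x : R := complex.Re `|x|.

Lemma realnormE x : (realnorm x)%:C = `|x|.
Proof. by rewrite /realnorm complexRe; apply/Creal_ReP/ger0_real. Qed.

Lemma realnorm_ge0 x : 0 <= realnorm x.
Proof. by rewrite -ler0c realnormE. Qed.

Lemma realnorm0 : realnorm 0 = 0.
Proof. by rewrite /realnorm normr0. Qed.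

Lemma realnorm_eq0 x : realnorm x = 0 -> x = 0.
Proof. by move=> x0; apply/eqP; rewrite -normr_eq0 -realnormE x0. Qed.

Lemma ler_realnormD x y : realnorm (x + y) <= realnorm x + realnorm y.
Proof. by rewrite -lecR rmorphD /= !realnormE ler_normD. Qed.

Lemma realnormZ (r : R) x : realnorm (r%:C *: x) = `|r| * realnorm x.
Proof.
apply: (@complexI R); rewrite rmorphM /= !realnormE normrZ; congr (_ * _).
by rewrite normc_def /= expr0n /= addr0 sqrtr_sqr.
Qed.

End realnorm.

(* The compactness proof is a parameter of the type C(K, H) because it is what
   makes the supremum norm a norm. *)
Definition ctsfun (R : realType) (K : topologicalType)
    (cptK : compact [set: K]) (H : normedModType R[i]) : Type :=
  continuousType K H.

Section ctsfun_normed.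
Variables (R : realType) (K : topologicalType) (cptK : compact [set: K]).
Variable H : normedModType R[i].

Local Notation C := (ctsfun cptK H).
Implicit Types f g : C.

HB.instance Definition _ := gen_eqMixin C.
HB.instance Definition _ := gen_choiceMixin C.

Lemma ctsfunP f g : f =1 g -> f = g.
Proof. by move=> fg; apply/continuousEP. Qed.

Definition mkctsfun (f : K -> H) (ctsf : continuous f) : C := mkcts ctsf.

Fact cts_zero : continuous (fun _ : K => 0 : H).
Proof. by move=> x; exact: cvg_cst. Qed.

Fact cts_opp f : continuous (fun x => - f x).
Proof. by move=> x; apply: cvgN; exact: cts_fun. Qed.

Fact cts_add f g : continuous (fun x => f x + g x).
Proof. by move=> x; apply: cvgD; exact: cts_fun. Qed.

Fact cts_scale (r : R) f : continuous (fun x => r%:C *: f x).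
Proof. by move=> x; apply: cvgZl_tmp; exact: cts_fun. Qed.

Definition ctsfun_zero : C := mkctsfun cts_zero.
Definition ctsfun_opp f : C := mkctsfun (@cts_opp f).
Definition ctsfun_add f g : C := mkctsfun (@cts_add f g).
Definition ctsfun_scale (r : R) f : C := mkctsfun (@cts_scale r f).

Fact ctsfun_addA : associative ctsfun_add.
Proof. by move=> f g h; apply/ctsfunP => x; exact: addrA. Qed.

Fact ctsfun_addC : commutative ctsfun_add.
Proof. by move=> f g; apply/ctsfunP => x; exact: addrC. Qed.

Fact ctsfun_add0 : left_id ctsfun_zero ctsfun_add.
Proof. by move=> f; apply/ctsfunP => x; exact: add0r. Qed.

Fact ctsfun_addN : left_inverse ctsfun_zero ctsfun_opp ctsfun_add.
Proof. by move=> f; apply/ctsfunP => x; exact: addNr. Qed.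

HB.instance Definition _ :=
  GRing.isZmodule.Build C ctsfun_addA ctsfun_addC ctsfun_add0 ctsfun_addN.

Fact ctsfun_scaleA (a b : R) f :
  ctsfun_scale a (ctsfun_scale b f) = ctsfun_scale (a * b) f.
Proof. by apply/ctsfunP => x /=; rewrite /mkcts scalerA -rmorphM. Qed.

Fact ctsfun_scale1 : left_id 1 ctsfun_scale.
Proof. by move=> f; apply/ctsfunP => x; exact: scale1r. Qed.

Fact ctsfun_scaleDr : right_distributive ctsfun_scale +%R.
Proof. by move=> a f g; apply/ctsfunP => x; exact: scalerDr. Qed.

Fact ctsfun_scaleDl f :
  {morph ctsfun_scale^~ f : a b / (a + b)%R >-> (a + b)%R}.
Proof.
by move=> a b; apply/ctsfunP => x /=; rewrite /mkcts rmorphD; exact: scalerDl.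
Qed.

HB.instance Definition _ := GRing.Zmodule_isLmodule.Build R C
  ctsfun_scaleA ctsfun_scale1 ctsfun_scaleDr ctsfun_scaleDl.

Definition supnorm f : R := sup (range (fun x => realnorm (f x))).

Lemma ctsfun_bounded f : has_ubound (range (fun x => realnorm (f x))).
Proof.
have loc (x : K) : setT x ->
    \forall y \near x & M \near +oo, realnorm (f y) <= M.
  move=> _; exists ([set y | realnorm (f y) < realnorm (f x) + 1],
                     [set M | realnorm (f x) + 1 < M]) => /=; last first.
    by move=> [y M] /= [fy fM]; exact: ltW (lt_trans fy fM).
  split; last by apply: nbhs_pinfty_gt; exact: num_real.
  have /cvgr_dist_lt /(_ 1 ltr01) := @cts_fun _ _ f x.
  apply: filterS => y /= fxy; rewrite -ltcR rmorphD /= !realnormE -ltrBlDl.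
  by rewrite (le_lt_trans _ fxy)// distrC lerB_dist.
have /compact_near_coveringP cov := cptK.
have [M [_ fM]] := cov R _ (fun M x => realnorm (f x) <= M) _ loc.
exists (M + 1) => _ [x _ <-]; apply: (fM (M + 1)) => //.
by rewrite ltrDl.
Qed.

Lemma ler_supnorm f x : realnorm (f x) <= supnorm f.
Proof. by apply: ub_le_sup; [exact: ctsfun_bounded|exists x]. Qed.

Lemma supnorm_le f (a : R) :
  0 <= a -> (forall x, realnorm (f x) <= a) -> supnorm f <= a.
Proof.
move=> a0 fa; rewrite /supnorm.
have [K0|K0] := eqVneq (range (fun x => realnorm (f x))) set0.
  by rewrite K0 sup0.
by apply: ge_sup; [exact/set0P|move=> _ [x _ <-]].
Qed.

Lemma supnorm_ge0 f : 0 <= supnorm f.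
Proof.
rewrite /supnorm.
have [->|/set0P[_ [x _ _]]] := eqVneq (range (fun x => realnorm (f x))) set0.
  by rewrite sup0.
exact: le_trans (realnorm_ge0 (f x)) (ler_supnorm f x).
Qed.

Fact supnormD f g : supnorm (f + g) <= supnorm f + supnorm g.
Proof.
apply: supnorm_le => [|x]; first by rewrite addr_ge0 ?supnorm_ge0.
by rewrite (le_trans (ler_realnormD _ _))// lerD ?ler_supnorm.
Qed.

Fact supnormZ (r : R) f : supnorm (r *: f) = `|r| * supnorm f.
Proof.
have le_supnormZ (s : R) g : supnorm (s *: g) <= `|s| * supnorm g.
  apply: supnorm_le => [|x]; first by rewrite mulr_ge0 ?supnorm_ge0.
  by rewrite [leLHS]realnormZ ler_wpM2l ?ler_supnorm.
apply/eqP; rewrite eq_le le_supnormZ /=.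
have [->|r0] := eqVneq r 0; first by rewrite normr0 mul0r supnorm_ge0.
rewrite -ler_pdivlMl ?normr_gt0// -normfV.
by rewrite -{1}(scalerK r0 f) le_supnormZ.
Qed.

Fact supnorm_eq0 f : supnorm f = 0 -> f = 0.
Proof.
move=> f0; apply/ctsfunP => x; apply: realnorm_eq0; apply/eqP.
by rewrite eq_le realnorm_ge0 andbT -f0 ler_supnorm.
Qed.

HB.instance Definition _ :=
  @Lmodule_isNormed.Build R C supnorm supnormD supnormZ supnorm_eq0.

End ctsfun_normed.

Lemma gt0_complexP (R : realType) (e : R[i]) :
  0 < e -> exists2 r : R, 0 < r & e = r%:C.
Proof.
case: e => a b e0; have /andP[/eqP/= b0 a0] : (b == 0) && (0 < a) by [].
by exists a; rewrite // b0.
Qed.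

Section ctsfun_complete.
Variables (R : realType) (K : topologicalType) (cptK : compact [set: K]).
Variable H : completeNormedModType R[i].

Local Notation C := (ctsfun cptK H).

Lemma ler_ctsfun_norm (f : C) x : `|f x| <= `|f|%:C.
Proof. by rewrite -realnormE lecR ler_supnorm. Qed.

Lemma ctsfun_complete (F : set_system C) :
  ProperFilter F -> cauchy F -> cvg F.
Proof.
move=> FF /cauchy_ballP cF.
have evcvg (x : K) : cvg ((fun f : C => f x) @ F).
  apply: cauchy_cvg; apply/cauchy_ballP => _ /gt0_complexP[e e0 ->].
  near_simpl; have := cF e e0; apply: filterS => -[f g] /=.
  rewrite -!ball_normE /= => fg.
  by rewrite (le_lt_trans (ler_ctsfun_norm (f - g) x))// ltcR.
pose l (x : K) : H := lim ((fun f : C => f x) @ F).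
have unif (e : R) : 0 < e ->
    \forall f \near F, forall x, `|l x - (f : C) x| <= e%:C.
  move=> e0; have e20 : 0 < e / 2 by rewrite divr_gt0.
  have near2 : \forall f \near F & h \near F, ball f (e / 2) h := cF _ e20.
  apply: filterS (nearP_dep near2) => f Ff x.
  have e2C0 : 0 < (e / 2)%:C :> R[i] by rewrite ltcR.
  have lx : (fun h : C => h x) @ F --> l x := evcvg x.
  have lF : \forall h \near F, `|l x - (h : C) x| < (e / 2)%:C.
    by move/cvgr_dist_lt: lx; apply.
  have [h [lh fh]] := filter_ex (filterI lF Ff).
  rewrite (splitr e) rmorphD /=.
  rewrite (le_trans (ler_distD (h x) _ _))// lerD ?(ltW lh)//.
  rewrite distrC (le_trans (ler_ctsfun_norm (f - h) x))// lecR.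
  by move: fh; rewrite -ball_normE => /ltW.
have lcts : continuous l.
  move=> x; apply/cvgrPdist_le => _ /gt0_complexP[e e0 ->].
  have e30 : 0 < e / 3 by rewrite divr_gt0.
  have [f lf] := filter_ex (unif _ e30).
  have e3C0 : 0 < (e / 3)%:C :> R[i] by rewrite ltcR.
  have /cvgr_dist_lt /(_ _ e3C0) := @cts_fun _ _ f x.
  apply: filterS => y /= /ltW fxy.
  have -> : e = e / 3 + e / 3 + e / 3 by lra.
  rewrite !rmorphD /= (le_trans (ler_distD (f y) _ _))// lerD//; last first.
    by rewrite distrC.
  by rewrite (le_trans (ler_distD (f x) _ _))// lerD.
apply/cvg_ex; exists (mkctsfun cptK lcts : C).
apply/cvgrPdist_le => e e0; have := unif e e0; apply: filterS => f lf.
by apply: supnorm_le => [|x]; [exact: ltW|rewrite -lecR realnormE; exact: lf].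
Qed.

HB.instance Definition _ := Uniform_isComplete.Build C ctsfun_complete.

End ctsfun_complete.

Section mazur_ulam.
Variable R : realType.

Definition unit_sphere (X : normedModType R) : set X := [set x | `|x| = 1].
Arguments unit_sphere : clear implicits.

Definition isometry_on (X Y : normedModType R) (A : set X) (f : X -> Y) :=
  forall x y, A x -> A y -> `|f x - f y| = `|x - y|.

(* A map between the unit spheres is represented by a map between the spaces
   sending one sphere into the other; its values off the sphere are irrelevant. *)
Definition mazur_ulam_property (X : completeNormedModType R) : Prop :=
  forall (Y : completeNormedModType R) (Delta : X -> Y),
    set_fun (unit_sphere X) (unit_sphere Y) Delta ->
    set_surj (unit_sphere X) (unit_sphere Y) Delta ->
    isometry_on (unit_sphere X) Delta ->
  exists T : {linear X -> Y},
    [/\ isometry_on [set: X] T, set_surj [set: X] [set: Y] T &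
        forall x, unit_sphere X x -> T x = Delta x].

End mazur_ulam.

(* Main.v *)
Require Import Defs.
From HB Require Import structures.
From mathcomp Require Import all_boot all_order all_algebra.
From mathcomp Require Import sesquilinear complex ring lra.
From mathcomp Require Import all_classical all_reals.
From mathcomp Require Import topology function_spaces normedtype derive trigo.

(* For a point t of K and a unit vector e, Hahn-Banach gives a linear functional
   phi on Y equal to 1 on Delta(F) and to -1 on Delta(-F), where F is the face
   {f | f(t) = e} of the unit ball: the convex hull of Delta(F) and -Delta(-F)
   stays in the unit sphere, because being at distance 2 from an average of
   points of F forces distance 2 from each of them.  It then suffices to show
   phi(Delta f) = Re <f(t), e> for all f in the sphere, since the functionals
   f |-> Re <f(t), e> separate points.

   Comparing f with nearby points of F and -F gives this equality up to an error
   at most |f(t)|^2 / 2.  If |f(s)| = 1 for some s <> t, metric midpoints inside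
   the face of s produce g in the same face with g(t) = f(t) / 2 and
   phi(Delta g) = phi(Delta f) / 2; iterating, the quadratic error must vanish.
   Functions attaining their norm only at t are limits of the previous ones if
   t is not isolated, and are handled by splitting f = (f1 + f2) / 2 otherwise.

   If K is a point, the sphere of Y satisfies |u + v|^2 + |u - v|^2 = 4, so the
   image of an orthonormal pair spans a Euclidean plane (Day), on which Delta
   has to be linear. *)

Set Implicit Arguments.
Unset Strict Implicit.
Unset Printing Implicit Defensive.

Import Order.TTheory GRing.Theory Num.Theory.
Import numFieldNormedType.Exports.
Local Open Scope classical_set_scope.
Local Open Scope ring_scope.

(** * Hahn-Banach *)

Section hahn_banach.
Variables (R : realType) (V : lmodType R).
Implicit Types (p q : V -> R) (x y : V) (C : set (V * R)).

Definition sublinear p :=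
  (forall x y, p (x + y) <= p x + p y) /\
  (forall r x, 0 <= r -> p (r *: x) = r * p x).

Lemma sublinear0 p : sublinear p -> p 0 = 0.
Proof. by move=> [_ /(_ 0 0 (lexx _))]; rewrite scale0r mul0r. Qed.

Lemma sublinear_geN p x : sublinear p -> - p (- x) <= p x.
Proof.
move=> sp; have := sp.1 x (- x).
by rewrite subrr sublinear0// -lerBlDr sub0r.
Qed.

(** A pair [(x, a)] of the cone stands for the constraint that a functional be at least [a] at
    [x]. *)
Definition convex_cone C :=
  [/\ C (0, 0), (forall u v, C u -> C v -> C (u.1 + v.1, u.2 + v.2)) &
      (forall r u, 0 <= r -> C u -> C (r *: u.1, r * u.2))].

(** Take [q x] to be the infimum of [p (x + u.1) - u.2] over the cone; the hypothesis on [C] bounds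
    it below by [- p (- x)]. A linear functional below [q] then satisfies every constraint of
    [C]. *)
Lemma sublinear_cone p C : sublinear p -> convex_cone C ->
    (forall u, C u -> u.2 <= p u.1) ->
  exists q, [/\ sublinear q, (forall x, q x <= p x) &
                (forall u, C u -> q (- u.1) <= - u.2)].
Proof.
move=> sp [C0 CD CZ] Cp.
pose A x := [set p (x + u.1) - u.2 | u in C].
have A0 x : A x !=set0 by exists (p (x + 0) - 0), (0, 0).
have Albd x : lbound (A x) (- p (- x)).
  move=> _ [u Cu <-]; have := sp.1 (x + u.1) (- x); have := Cp _ Cu.
  rewrite addrAC subrr add0r; lra.
have Alb x : has_lbound (A x) by exists (- p (- x)).
have Ale x u : C u -> inf (A x) <= p (x + u.1) - u.2.
  by move=> Cu; apply: ge_inf => //; exists u.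
have Age x a : (forall u, C u -> a <= p (x + u.1) - u.2) -> a <= inf (A x).
  by move=> ha; apply: lb_le_inf => // _ [u Cu <-]; exact: ha.
(* One inequality is enough: the reverse is this one for [r^-1] and [r *: x]. *)
have AZ r x : 0 < r -> r * inf (A x) <= inf (A (r *: x)).
  move=> r0; apply: (Age) => u Cu.
  have /Ale : C (r^-1 *: u.1, r^-1 * u.2) by apply: CZ => //; rewrite invr_ge0 ltW.
  move=> /(_ x)/= /(ler_wpM2l (ltW r0)).
  rewrite mulrBr mulrA divff ?gt_eqF// mul1r -sp.2 ?(ltW r0)//.
  by rewrite scalerDr scalerA divff ?gt_eqF// scale1r.
exists (fun x => inf (A x)); split.
- split=> [x y|r x].
    rewrite -lerBlDl; apply: (Age) => u Cu; rewrite lerBlDl -lerBlDr.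
    apply: (Age) => v Cv; rewrite lerBlDr.
    rewrite (le_trans (Ale _ _ (CD _ _ Cu Cv)))//=.
    have := sp.1 (x + v.1) (y + u.1).
    rewrite addrACA [v.1 + _]addrC; lra.
  rewrite le_eqVlt => /predU1P[<-|r0].
    rewrite scale0r mul0r; apply/eqP; rewrite eq_le.
    rewrite (le_trans (Ale _ _ C0)) ?addr0 ?sublinear0 ?subrr//=.
    by apply: (Age) => u Cu; rewrite add0r subr_ge0 Cp.
  apply/eqP; rewrite eq_le AZ// andbT -ler_pdivrMl//.
  have := AZ r^-1 (r *: x); rewrite invr_gt0 => /(_ r0) /le_trans; apply.
  by rewrite scalerA mulVf ?gt_eqF// scale1r.
- by move=> x; apply: le_trans (Ale _ _ C0) _; rewrite addr0 subr0.
- move=> u Cu; apply: le_trans (Ale _ _ Cu) _.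
  by rewrite addNr sublinear0// sub0r.
Qed.

(** Zorn's lemma for the reversed pointwise order. The pointwise infimum of a nonempty chain is
    sublinear because of two members one lies below the other, and finite because every member is at
    least [- p (- x)] at [x]. *)
Lemma sublinear_minimal p : sublinear p ->
  exists q, [/\ sublinear q, (forall x, q x <= p x) &
    forall q', sublinear q' -> (forall x, q' x <= q x) -> q' = q].
Proof.
move=> sp; pose T := {q : V -> R | sublinear q /\ forall x, q x <= p x}.
pose p' : T := exist _ p (conj sp (fun x => lexx _)).
pose rT (f g : T) := `[< forall x, sval g x <= sval f x >].
have [||||[q [sq qp]] qmin] := @Zorn T rT.
- by move=> f; apply/asboolP.
- move=> f g h /asboolP gf /asboolP hg; apply/asboolP => x.
  exact: le_trans (hg x) (gf x).
- move=> [f hf] [g hg] /asboolP/= gf /asboolP/= fg.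
  by apply: eq_exist => /=; apply/funext => x; apply/eqP; rewrite eq_le gf fg.
- move=> A totA; have [A0|[f0 Af0]] : (A = set0) \/ (A !=set0).
    by case: (eqVneq A set0) => [|/set0P]; [left|right].
    by exists p' => f; rewrite A0.
  pose B x := [set sval f x | f in A].
  have B0 x : B x !=set0 by exists (sval f0 x), f0.
  have Blb x : has_lbound (B x).
    exists (- p (- x)) => _ [[f [sf fp]] _ <-] /=.
    by apply: le_trans (sublinear_geN x sf); rewrite lerN2.
  have Ble x f : A f -> inf (B x) <= sval f x.
    by move=> Af; apply: ge_inf => //; exists f.
  have Bge x a : (forall f, A f -> a <= sval f x) -> a <= inf (B x).
    by move=> ha; apply: lb_le_inf => // _ [f Af <-]; exact: ha.
  have sB : sublinear (fun x => inf (B x)).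
    split=> [x y|r x].
      rewrite -lerBlDl; apply: (Bge) => f Af; rewrite lerBlDl -lerBlDr.
      apply: (Bge) => g Ag; rewrite lerBlDr.
      have [h [Ah hf hg]] : exists h, [/\ A h, forall x, sval h x <= sval f x &
          forall x, sval h x <= sval g x].
        by have [/asboolP ?|/asboolP ?] := totA _ _ Af Ag;
          [exists g|exists f].
      apply: le_trans (Ble _ _ Ah) _.
      by apply: le_trans ((svalP h).1.1 _ _) _; rewrite lerD.
    rewrite le_eqVlt => /predU1P[<-|r0].
      rewrite scale0r mul0r; apply/eqP; rewrite eq_le.
      rewrite (le_trans (Ble _ _ Af0)) ?(sublinear0 (svalP f0).1)//=.
      by apply: (Bge) => f Af; rewrite (sublinear0 (svalP f).1).
    apply/eqP; rewrite eq_le; apply/andP; split.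
      rewrite -ler_pdivrMl//; apply: (Bge) => f Af.
      by rewrite ler_pdivrMl// -(svalP f).1.2 ?(ltW r0)// Ble.
    by apply: (Bge) => f Af; rewrite (svalP f).1.2 ?(ltW r0)// ler_pM2l// Ble.
  have Bp x : inf (B x) <= p x.
    exact: le_trans (Ble _ _ Af0) ((svalP f0).2 x).
  pose b : T := exist _ (fun x => inf (B x)) (conj sB Bp).
  by exists b => f Af; apply/asboolP => x; exact: Ble.
exists q; split=> // q' sq' q'q.
have q'p x : q' x <= p x by exact: le_trans (q'q x) (qp x).
pose q1 : T := exist _ q' (conj sq' q'p).
have /(congr1 sval) /= : q1 = exist _ q (conj sq qp); last by [].
apply: qmin.
exact/asboolP.
Qed.

(** A minimal sublinear [q] is linear: imposing the ray through [(a, q a)] by [sublinear_cone]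
    yields a sublinear function below [q], hence [q] itself, so [q (- a) <= - q a]. *)
Lemma hahn_banach_cone p C : sublinear p -> convex_cone C ->
    (forall u, C u -> u.2 <= p u.1) ->
  exists phi : {scalar V},
    (forall x, phi x <= p x) /\ (forall u, C u -> u.2 <= phi u.1).
Proof.
move=> sp cC Cp; have [p1 [sp1 p1p p1C]] := sublinear_cone sp cC Cp.
have [q [sq qp1 qmin]] := sublinear_minimal sp1.
have qN a : q (- a) = - q a.
  apply/eqP; rewrite eq_le; apply/andP; split; last first.
    by have := sublinear_geN (- a) sq; rewrite opprK.
  pose Ca := [set (t *: a, t * q a) | t in [set t : R | 0 <= t]].
  have [|u [t t0 <-]/=|q' [sq' q'q q'C]] := @sublinear_cone q Ca sq.
  - split; first by exists 0; rewrite //= ?scale0r ?mul0r.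
      move=> _ _ [t /= t0 <-] [s /= s0 <-]; exists (t + s); first exact: addr_ge0.
      by rewrite /= scalerDl mulrDl.
    move=> r _ r0 [t /= t0 <-]; exists (r * t); first exact: mulr_ge0.
    by rewrite /= scalerA mulrA.
  - by rewrite sq.2.
  - rewrite -(qmin _ sq' q'q).
    have := q'C (a, q a); rewrite /= (qmin _ sq' q'q); apply.
    by exists 1; rewrite /= ?scale1r ?mul1r.
have qD x y : q (x + y) = q x + q y.
  apply/eqP; rewrite eq_le sq.1/= -lerN2 -qN !opprD -!qN.
  exact: sq.1.
have qZ r x : q (r *: x) = r * q x.
  have [r0|r0] := leP 0 r; first exact: sq.2.
  by rewrite -[r *: x]opprK qN -scaleNr sq.2 ?mulNr ?opprK// oppr_ge0 ltW.
have qlin : scalar q by move=> r x y; rewrite qD qZ.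
pose phi : {scalar V} := HB.pack q (GRing.isLinear.Build R V R *%R q qlin).
exists phi; split=> [x|u Cu] /=; first exact: le_trans (qp1 x) (p1p x).
by rewrite -lerN2 -qN; exact: le_trans (qp1 _) (p1C _ Cu).
Qed.

End hahn_banach.

(** * Functionals supporting the image of a face *)

Section norm_additivity.
Variables (R : realType) (V : normedModType R).
Implicit Types (a b v : V).

Lemma normZ_ge0 (r : R) v : 0 <= r -> `|r *: v| = r * `|v|.
Proof. by move=> r0; rewrite normrZ ger0_norm. Qed.

(** For [s <= r] write the combination as [r *: (a + b) - (r - s) *: b] and use the reverse triangle
    inequality. *)
Lemma normD_eq_scale a b (r s : R) : 0 <= r -> 0 <= s ->
  `|a + b| = `|a| + `|b| -> `|r *: a + s *: b| = r * `|a| + s * `|b|.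
Proof.
move=> r0 s0 ab; apply/eqP; rewrite eq_le -{1}normZ_ge0// -{1}[s * _]normZ_ge0//.
rewrite ler_normD/=; wlog sr : a b r s r0 s0 ab / s <= r.
  move=> wlg; have [sr|/ltW rs] := leP s r; first exact: wlg.
  by rewrite addrC [leRHS](congr1 _ (addrC _ _)) wlg// addrC ab addrC.
have -> : r *: a + s *: b = r *: (a + b) - (r - s) *: b.
  by rewrite scalerDr scalerBl opprB [s *: b - _]addrC addrA addrK.
apply: le_trans (lerB_dist _ _); rewrite !normZ_ge0 ?subr_ge0// ab; lra.
Qed.

End norm_additivity.

Section face_functional.
Variables (R : realType) (X Y : normedModType R) (Delta : X -> Y).
Hypothesis Dfun : set_fun (@unit_sphere R X) (@unit_sphere R Y) Delta.
Hypothesis Dsurj : set_surj (@unit_sphere R X) (@unit_sphere R Y) Delta.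
Hypothesis Diso : isometry_on (@unit_sphere R X) Delta.

Lemma Delta_norm x : `|x| = 1 -> `|Delta x| = 1. Proof. exact: Dfun. Qed.

Lemma Delta_onto y : `|y| = 1 -> exists2 x, `|x| = 1 & Delta x = y.
Proof. by move=> /Dsurj[x x1 <-]; exists x. Qed.

Lemma Delta_dist x y : `|x| = 1 -> `|y| = 1 ->
  `|Delta x - Delta y| = `|x - y|.
Proof. exact: Diso. Qed.

Variable l : {scalar X}.
Hypothesis l_le : forall x, l x <= `|x|.

(** [u.2] is a point where the functional has to be 1, and [u.1] keeps the point of the face it
    comes from, so that averages can be formed in [X]. Both forms of [u.2] occur since [Delta] is
    not known to be odd. *)
Definition face_pair (u : X * Y) :=
  [/\ `|u.1| = 1, l u.1 = 1 & u.2 = Delta u.1 \/ u.2 = - Delta (- u.1)].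

Lemma face_pair_norm u : face_pair u -> `|u.2| = 1.
Proof.
by case=> u1 _ [->|->]; rewrite ?normrN Delta_norm// normrN.
Qed.

(** Each distance is at most 2 while their weighted mean is at least [|w - x| = 2], so no term of
    positive weight falls short. *)
Lemma average_dist2 (s : seq (R * (X * Y))) x w :
  (forall i, i \in s -> 0 <= i.1 /\ `|i.2.1| = 1) ->
  0 < \sum_(i <- s) i.1 ->
  x = (\sum_(i <- s) i.1)^-1 *: \sum_(i <- s) i.1 *: i.2.1 ->
  `|w| = 1 -> `|w - x| = 2 ->
  forall i, i \in s -> 0 < i.1 -> `|w - i.2.1| = 2.
Proof.
move=> hs L0 xE w1 wx i si i0; set L := \sum_(i <- s) i.1 in L0 xE.
have le2 j : j \in s -> `|w - j.2.1| <= 2.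
  by move=> /hs[_ j1]; rewrite (le_trans (ler_normB _ _))// w1 j1.
have sum_le0 : \sum_(j <- s) j.1 * (2 - `|w - j.2.1|) <= 0.
  under eq_bigr do rewrite mulrBr.
  rewrite sumrB -mulr_suml subr_le0 -/L -wx -(normZ_ge0 _ (ltW L0)).
  have -> : L *: (w - x) = \sum_(j <- s) j.1 *: (w - j.2.1).
    under eq_bigr do rewrite scalerBr.
    by rewrite sumrB -scaler_suml -/L scalerBr xE scalerA divff ?gt_eqF// scale1r.
  apply: le_trans (ler_norm_sum _ _ _) _.
  by rewrite !big_seq ler_sum// => j /hs[j0 _]; rewrite normZ_ge0.
have ge0 j : j \in s -> 0 <= j.1 * (2 - `|w - j.2.1|).
  by move=> sj; rewrite mulr_ge0 ?subr_ge0 ?le2//; case: (hs _ sj).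
have : \sum_(j <- s | j \in s) j.1 * (2 - `|w - j.2.1|) == 0.
  by rewrite eq_le -big_seq sum_le0 big_seq sumr_ge0.
rewrite psumr_eq0// => /allP/(_ _ si); rewrite si/= mulf_eq0 gt_eqF//= subr_eq0.
by move=> /eqP.
Qed.

(** The average [x] of the points [u.1] has norm 1 because [l x = 1]. Starting from
    [Delta x - Delta (- x)], of norm 2, the terms are added one at a time, and the norm grows by the
    full weight each time. *)
Lemma face_image_convex (s : seq (R * (X * Y))) :
  (forall i, i \in s -> 0 <= i.1 /\ face_pair i.2) ->
  \sum_(i <- s) i.1 <= `|\sum_(i <- s) i.1 *: i.2.2|.
Proof.
move=> hs; set L := \sum_(i <- s) i.1.
have : 0 <= L by rewrite /L big_seq sumr_ge0// => i /hs[].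
rewrite le_eqVlt => /predU1P[<-//|L0].
pose x := L^-1 *: \sum_(i <- s) i.1 *: i.2.1.
have hs1 i : i \in s -> 0 <= i.1 /\ `|i.2.1| = 1 by case/hs => ? [].
have xle1 : `|x| <= 1.
  rewrite normZ_ge0 ?invr_ge0 ?(ltW L0)// ler_pdivrMl// mulr1.
  apply: le_trans (ler_norm_sum _ _ _) _.
  rewrite /L !big_seq ler_sum// => i /hs1[i0 i1].
  by rewrite normZ_ge0// i1 mulr1.
have lx : l x = 1.
  rewrite linearZ linear_sum/=; have -> : \sum_(i <- s) l (i.1 *: i.2.1) = L.
    rewrite /L !big_seq; apply: eq_bigr => i /hs[_ [_ li _]].
    by rewrite linearZ/= li mulr1.
  by rewrite mulVf ?gt_eqF.
have x1 : `|x| = 1 by apply/eqP; rewrite eq_le xle1 -{1}lx l_le.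
have Nx1 : `|- x| = 1 by rewrite normrN.
(* Adding this seed is harmless: once the total norm is 2 plus the weights, the seed accounts for at
   most 2 of it. *)
pose w0 := Delta x - Delta (- x).
have w0n : `|w0| = 2.
  by rewrite /w0 Delta_dist// opprK -mulr2n normrMn x1.
suff : forall s', {subset s' <= s} ->
    `|w0 + \sum_(i <- s') i.1 *: i.2.2| = 2 + \sum_(i <- s') i.1.
  move=> /(_ s (fun _ => id)); rewrite -/L => E.
  have := ler_normD w0 (\sum_(i <- s) i.1 *: i.2.2).
  by rewrite E w0n lerD2l.
elim=> [_|i s' IH ss]; first by rewrite !big_nil !addr0.
have {}IH : `|w0 + \sum_(i <- s') i.1 *: i.2.2| = 2 + \sum_(i <- s') i.1.
  by apply: IH => j js; apply: ss; rewrite inE js orbT.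
have si : i \in s by apply: ss; rewrite inE eqxx.
rewrite !big_cons; set S := \sum_(i <- s') _ in IH *.
set W := \sum_(i <- s') _ in IH *.
have [i0 fi] := hs _ si.
have W0 : 0 <= W.
  rewrite /W big_seq sumr_ge0// => j js.
  by have [] := hs j _ => //; apply: ss; rewrite inE js orbT.
have Sn : `|S| <= W.
  rewrite /S /W; apply: le_trans (ler_norm_sum _ _ _) _.
  rewrite !big_seq ler_sum// => j js.
  have [|j0 fj] := hs j _; first by apply: ss; rewrite inE js orbT.
  by rewrite normZ_ge0// (face_pair_norm fj) mulr1.
move: i0; rewrite le_eqVlt => /predU1P[<-|i0]; first by rewrite scale0r !add0r.
have V0 : 0 < 2 + W by rewrite ltr_wpDr.
pose y := (2 + W)^-1 *: (w0 + S).
have y1 : `|y| = 1 by rewrite normZ_ge0 ?invr_ge0 ?ltW// IH mulVf ?gt_eqF.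
(* As [w0 + S] has norm [2 + W], such a splitting is additive for the norm, and so are its
   nonnegative combinations. *)
have yD a b : w0 + S = a + b -> `|a| = 1 -> `|b| <= 1 + W -> `|y + a| = 2.
  move=> ab a1 bW.
  have b1 : `|b| = 1 + W.
    apply/eqP; rewrite eq_le bW/=; have := ler_normD a b.
    rewrite -ab IH a1; lra.
  have -> : y + a = (1 + (2 + W)^-1) *: a + (2 + W)^-1 *: b.
    by rewrite /y ab scalerDr addrAC scalerDl scale1r [a + _]addrC.
  rewrite normD_eq_scale ?addr_ge0 ?invr_ge0 ?(ltW V0)//.
    by rewrite a1 b1; field; rewrite gt_eqF.
  by rewrite -ab IH a1 b1; ring.
have yx : `|y + Delta x| = 2.
  apply: (yD _ (- Delta (- x) + S)); rewrite ?addrA ?Delta_norm//.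
  by rewrite (le_trans (ler_normD _ _))// normrN Delta_norm// lerD2l.
have yNx : `|y - Delta (- x)| = 2.
  apply: (yD _ (Delta x + S)); rewrite ?normrN ?Delta_norm//.
    by rewrite addrA; congr (_ + _); rewrite addrC.
  by rewrite (le_trans (ler_normD _ _))// Delta_norm// lerD2l.
(* Pull [- y], or [y] for a point of the second form, back through [Delta]: distance 2 from [x],
   respectively [- x], passes to the individual points of the average. *)
have yi : `|y + i.2.2| = 2.
  have [fi1 _ [->|->]] := fi.
  - have [w w1 wy] := Delta_onto (etrans (normrN y) y1).
    rewrite -normrN opprD -wy Delta_dist//.
    apply: (average_dist2 hs1 L0 (erefl x)) => //.
    by rewrite -Delta_dist// wy -opprD normrN.
  - have [v v1 vy] := Delta_onto y1.
    rewrite -vy Delta_dist ?normrN// opprK -normrN opprD.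
    apply: (average_dist2 hs1 L0 (erefl x)) => //; first by rewrite normrN.
    by rewrite -opprD normrN -[x in v + x]opprK -Delta_dist// vy.
have -> : w0 + (i.1 *: i.2.2 + S) = (2 + W) *: y + i.1 *: i.2.2.
  by rewrite addrCA addrC scalerA divff ?gt_eqF// scale1r.
rewrite normD_eq_scale ?(ltW i0) ?(ltW V0)//.
  by rewrite y1 (face_pair_norm fi) !mulr1; ring.
by rewrite yi y1 (face_pair_norm fi).
Qed.

(** Hahn-Banach for the cone generated by the pairs [(u.2, 1)], which lies below the norm by
    [face_image_convex]. The result is at least 1 on the unit vectors [u.2], hence equal to 1. *)
Lemma face_functional : exists phi : {scalar Y},
  [/\ forall y, phi y <= `|y|,
      forall f, `|f| = 1 -> l f = 1 -> phi (Delta f) = 1 &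
      forall f, `|f| = 1 -> l f = -1 -> phi (Delta f) = -1].
Proof.
pose good (s : seq (R * (X * Y))) :=
  forall i, i \in s -> 0 <= i.1 /\ face_pair i.2.
pose C := [set u | exists2 s, good s &
  u = (\sum_(i <- s) i.1 *: i.2.2, \sum_(i <- s) i.1)].
have [|||phi [phi_le phiC]] := @hahn_banach_cone R Y (fun y => `|y|) C.
- by split=> [x y|r x r0]; [exact: ler_normD|exact: normZ_ge0].
- split.
  + by exists [::]; rewrite ?big_nil.
  + move=> _ _ [s gs ->] [t gt ->]; exists (s ++ t); last by rewrite !big_cat.
    by move=> i; rewrite mem_cat => /orP[/gs|/gt].
  + move=> r _ r0 [s gs ->]; exists [seq (r * i.1, i.2) | i <- s].
      by move=> _ /mapP[i /gs[i0 fi] ->]; split; rewrite ?mulr_ge0.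
    rewrite !big_map/= scaler_sumr mulr_sumr; congr (_, _).
    by apply: eq_bigr => i _; rewrite scalerA.
- by move=> _ [s gs ->]; exact: face_image_convex.
have phi1 u : face_pair u -> phi u.2 = 1.
  move=> fu; apply/eqP; rewrite eq_le -{1}(face_pair_norm fu) phi_le/=.
  apply: (phiC (u.2, 1)); exists [:: (1, u)]; last by rewrite !big_seq1 scale1r.
  by move=> i; rewrite inE => /eqP ->; split.
exists phi; split=> // f f1 lf.
  by apply: (phi1 (f, Delta f)); split=> //; left.
have := phi1 (- f, - Delta f).
rewrite /= linearN /= => /(_ _)/(canRL opprK); apply.
by split; rewrite /= ?normrN ?linearN ?lf ?opprK//; right.
Qed.

End face_functional.

(** * Linear extension from a separating family *)

(** The positively homogeneous extension [T] satisfies [phi i (T f) = l i f]. The [phi i] separate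
    points of [Y], because a unit vector is some [Delta k] and some [l i k] is 1; hence [T] inherits
    linearity from the [l i]. *)
Lemma sphere_linear_extension (R : realType) (X Y : normedModType R)
    (Delta : X -> Y) (I : Type) (l : I -> {scalar X}) (phi : I -> {scalar Y}) :
    set_fun (@unit_sphere R X) (@unit_sphere R Y) Delta ->
    set_surj (@unit_sphere R X) (@unit_sphere R Y) Delta ->
    (forall f : X, `|f| = 1 -> exists i, l i f = 1) ->
    (forall i f, `|f| = 1 -> phi i (Delta f) = l i f) ->
  exists T : {linear X -> Y},
    [/\ isometry_on [set: X] T, set_surj [set: X] [set: Y] T &
        forall x, @unit_sphere R X x -> T x = Delta x].
Proof.
move=> Dfun Dsurj hl hphi.
(* At 0 the outer factor gives 0, whatever [Delta] does off the sphere. *)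
pose T (f : X) := `|f| *: Delta (`|f|^-1 *: f).
have unit_normalize (Z : normedModType R) (f : Z) : f != 0 ->
    `|(`|f|^-1 *: f)| = 1.
  by move=> f0; rewrite normrZ normfV normr_id mulVf// normr_eq0.
have phiT i f : phi i (T f) = l i f.
  rewrite /T linearZ/=; have [->|f0] := eqVneq f 0.
    by rewrite normr0 mul0r linear0.
  rewrite hphi ?unit_normalize// linearZ/= mulrA divff ?mul1r// normr_eq0//.
have sep y : (forall i, phi i y = 0) -> y = 0.
  move=> y0; apply/eqP/negPn/negP => yN0.
  have [k k1 kE] := Dsurj _ (unit_normalize _ _ yN0).
  have [i lk] := hl _ k1; have := hphi i _ k1.
  rewrite lk kE linearZ/= y0 mulr0 => /eqP.
  by rewrite eq_sym oner_eq0.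
have Tlin : linear T.
  move=> a f g; apply/eqP; rewrite -subr_eq0; apply/eqP/sep => i.
  rewrite linearB/= phiT [phi i (_ + _)]linearD/= [phi i (a *: _)]linearZ/= !phiT.
  by rewrite linearD linearZ/= subrr.
pose TL : {linear X -> Y} := HB.pack T (GRing.isLinear.Build R X Y *:%R T Tlin).
have normT f : `|T f| = `|f|.
  rewrite /T normrZ normr_id; have [->|f0] := eqVneq f 0.
    by rewrite normr0 mul0r.
  by rewrite (Dfun _ (unit_normalize _ _ f0)) mulr1.
exists TL; split=> [x y _ _|y _|x x1] /=.
- by rewrite -(linearB TL) /= normT.
- have [->|y0] := eqVneq y 0.
    by exists 0 => //; rewrite /= /T normr0 scale0r.
  have [k k1 kE] := Dsurj _ (unit_normalize _ _ y0).
  exists (`|y| *: k) => //=; have kk : `|k| = 1 := k1.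
  rewrite /T normrZ normr_id kk mulr1 scalerA mulVf ?normr_eq0// scale1r kE.
  by rewrite scalerA divff ?scale1r// normr_eq0.
- by rewrite /T x1 invr1 !scale1r.
Qed.

(** * The real inner product *)

Section real_inner_product.
Variables (R : realType) (H : normedModType R[i]) (dot : {dot H for Num.conj}).
Hypothesis normE : forall x : H, `|x| ^+ 2 = dot x x.
Implicit Types (a b c x y : H) (r s : R).

Definition ip a b : R := complex.Re (dot a b).

Lemma ipDl a b c : ip (a + b) c = ip a c + ip b c.
Proof. by rewrite /ip linearDl raddfD. Qed.

Lemma ipC a b : ip a b = ip b a.
Proof. by rewrite /ip hermC/= expr0 mul1r; case: (dot b a). Qed.

Lemma ipZl r a b : ip (r%:C%C *: a) b = r * ip a b.
Proof.
rewrite /ip linearZl_LR /=; case: (dot a b) => u v /=.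
by rewrite mul0r subr0.
Qed.

Lemma ipDr a b c : ip a (b + c) = ip a b + ip a c.
Proof. by rewrite ipC ipDl !(ipC a). Qed.

Lemma ipNl a b : ip (- a) b = - ip a b.
Proof. by rewrite /ip linearNl raddfN. Qed.

Lemma ipNr a b : ip a (- b) = - ip a b.
Proof. by rewrite ipC ipNl ipC. Qed.

Lemma ipxx a : ip a a = realnorm a ^+ 2.
Proof.
by rewrite /ip -normE -realnormE -rmorphXn.
Qed.

Lemma sqr_realnormD a b :
  realnorm (a + b) ^+ 2 = realnorm a ^+ 2 + realnorm b ^+ 2 + 2 * ip a b.
Proof. by rewrite -!ipxx ipDl !ipDr (ipC b a); ring. Qed.

Lemma realnormN a : realnorm (- a) = realnorm a.
Proof. by rewrite /realnorm normrN. Qed.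

Lemma sqr_realnormB a b :
  realnorm (a - b) ^+ 2 = realnorm a ^+ 2 + realnorm b ^+ 2 - 2 * ip a b.
Proof. by rewrite sqr_realnormD realnormN ipNr mulrN. Qed.

(** This is [n <= (1 + n ^+ 2) / 2] for [n = realnorm (a + b)], with the square expanded. *)
Lemma realnormD_le_ip a b : realnorm b = 1 ->
  realnorm (a + b) <= 1 + ip a b + realnorm a ^+ 2 / 2.
Proof.
move=> b1; have := sqr_realnormD a b; rewrite b1.
have := sqr_ge0 (realnorm (a + b) - 1); nra.
Qed.

(** Cauchy-Schwarz, read off from the squared triangle inequality. *)
Lemma ip_le a b : ip a b <= realnorm a * realnorm b.
Proof.
have := sqr_realnormD a b; have := ler_realnormD a b.
have := realnorm_ge0 (a + b); have := realnorm_ge0 a; have := realnorm_ge0 b.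
nra.
Qed.

Lemma parallelogram a b :
  realnorm (a + b) ^+ 2 + realnorm (a - b) ^+ 2 =
  2 * realnorm a ^+ 2 + 2 * realnorm b ^+ 2.
Proof. rewrite sqr_realnormD sqr_realnormB; ring. Qed.

Lemma realnorm_strictly_convex a b (r : R) :
  realnorm a <= r -> realnorm b <= r -> 2 * r <= realnorm (a + b) -> a = b.
Proof.
move=> ar br abr; apply/eqP; rewrite -subr_eq0; apply/eqP/realnorm_eq0.
have := parallelogram a b; have := realnorm_ge0 a; have := realnorm_ge0 b.
move=> a0 b0 E; apply/eqP; rewrite -sqrf_eq0 eq_le sqr_ge0 andbT.
nra.
Qed.

Lemma ip1_eq a b : realnorm a <= 1 -> realnorm b = 1 -> ip a b = 1 -> a = b.
Proof.
move=> a1 b1 ab; apply: (@realnorm_strictly_convex _ _ 1) => //; first by rewrite b1.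
have := sqr_realnormD a b; rewrite ab b1.
have := ip_le a b; rewrite ab b1; have := realnorm_ge0 (a + b); nra.
Qed.

(** Metric midpoints are unique in [H]: [a - c] and [c - b] have sum [a - b] and each at most half
    its norm, so strict convexity makes them equal. *)
Lemma realnorm_midpoint a b c : realnorm (c - a) <= realnorm (a - b) / 2 ->
  realnorm (c - b) <= realnorm (a - b) / 2 -> c = 2^-1%:C%C *: (a + b).
Proof.
move=> ca cb; have E : a - c = c - b.
  apply: (@realnorm_strictly_convex _ _ (realnorm (a - b) / 2)) => //.
    by rewrite -realnormN opprB.
  by rewrite addrA addrNK mulrC divfK// pnatr_eq0.
have -> : a + b = 2%:R *: c.
  by rewrite scaler_nat mulr2n -[a](subrK c) E addrAC addrNK.
by rewrite fmorphV rmorph_nat scalerA mulVf ?scale1r// pnatr_eq0.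
Qed.

End real_inner_product.

(** * Continuous functions with values in H *)

Section ctsfun_tools.
Variables (R : realType) (K : topologicalType) (cptK : compact [set: K]).
Variables (H : normedModType R[i]) (dot : {dot H for Num.conj}).
Hypothesis normE : forall x : H, `|x| ^+ 2 = dot x x.
Local Notation C := (ctsfun cptK H).
Local Notation "<< x , y >>" := (ip dot x y).
Implicit Types (f g : C) (t s : K) (e h : H).

Lemma normc_real (r : R) : `|r%:C%C| = `|r|%:C%C.
Proof. by rewrite normc_def /= expr0n /= addr0 sqrtr_sqr. Qed.

Lemma continuous_real_complex (T : topologicalType) (u : T -> R) :
  continuous u -> continuous (fun x => (u x)%:C%C : (R[i] : numFieldType)).
Proof.
move=> cu x; apply/cvgrPdist_lt => _ /gt0_complexP[r r0 ->].
have /cvgrPdist_lt/(_ _ r0) := cu x; apply: filterS => y.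
by rewrite -rmorphB /= normc_real ltcR.
Qed.

Lemma continuous_realnorm (T : topologicalType) (u : T -> H) :
  continuous u -> continuous (fun x => realnorm (u x)).
Proof.
move=> cu x; apply/cvgrPdist_lt => r r0.
have r0C : 0 < r%:C%C :> R[i] by rewrite ltcR.
have /cvgrPdist_lt/(_ _ r0C) := cu x; apply: filterS => y.
rewrite -realnormE ltcR; apply: le_lt_trans.
rewrite -lecR -normc_real rmorphB /= !realnormE.
exact: ler_dist_dist.
Qed.

Fact cts_mul (u : K -> R) (cu : continuous u) f :
  continuous (fun x => (u x)%:C%C *: f x).
Proof.
move=> x; have cf : f y @[y --> x] --> f x by exact: cts_fun.
exact: (cvgZ (continuous_real_complex cu (x := x)) cf).
Qed.

Definition ctsmul u (cu : continuous u) f : C := mkctsfun cptK (@cts_mul u cu f).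

Definition ctscst h : C := mkctsfun cptK (@cst_continuous K H h).

Lemma normr_ctsfun_le f (a : R) : 0 <= a ->
  (forall x, realnorm (f x) <= a) -> `|f| <= a.
Proof. exact: supnorm_le. Qed.

Lemma ler_realnorm f x : realnorm (f x) <= `|f|.
Proof. exact: ler_supnorm. Qed.

Lemma norm_attained f : `|f| = 1 -> exists x, realnorm (f x) = 1.
Proof.
(* Over an empty [K] every function has norm 0, so the sphere is empty. *)
move=> f1; have [K0|K0] := eqVneq [set: K] set0.
  have : `|f| <= 0 by apply: normr_ctsfun_le => // x; have : setT x by []; rewrite K0.
  by rewrite f1 ler10.
have cf : {within [set: K], continuous (fun x => realnorm (f x))}.
  by apply: continuous_subspaceT; apply: continuous_realnorm; exact: cts_fun.
have [c _ cmax] := compact_EVT_max ((set0P _).1 K0) cptK cf.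
exists c; apply/eqP; rewrite eq_le -{1}f1 ler_realnorm/= -f1.
by apply: normr_ctsfun_le => [|x]; [exact: realnorm_ge0|apply: cmax; rewrite inE].
Qed.

Definition evip t e f : R := << f t, e >>.

Fact evip_scalar t e : scalar (evip t e).
Proof. by move=> r f g; rewrite /evip [_ t]/(_ + _) ipDl ipZl. Qed.

HB.instance Definition _ t e :=
  GRing.isLinear.Build R C R *%R (evip t e) (@evip_scalar t e).

Lemma evip_le t e f : realnorm e = 1 -> evip t e f <= `|f|.
Proof.
by move=> e1; apply: le_trans (ip_le normE _ _) _; rewrite e1 mulr1 ler_realnorm.
Qed.

Lemma sphere_norm f s : (forall x, realnorm (f x) <= 1) -> realnorm (f s) = 1 ->
  `|f| = 1.
Proof.
by move=> fle fs; apply/eqP; rewrite eq_le normr_ctsfun_le//= -fs ler_realnorm.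
Qed.

Lemma sphere_le1 f x : `|f| = 1 -> realnorm (f x) <= 1.
Proof. by move=> <-; exact: ler_realnorm. Qed.

Lemma convex_combination_le (r a : R) (x y : H) : 0 <= r <= 1 ->
  realnorm x <= a -> realnorm y <= a ->
  realnorm ((1 - r)%:C%C *: x + r%:C%C *: y) <= a.
Proof.
move=> /andP[r0 r1] xa ya; apply: le_trans (ler_realnormD _ _) _.
rewrite !realnormZ !ger0_norm ?subr_ge0//.
have := ler_wpM2l r0 ya; have : (1 - r) * realnorm x <= (1 - r) * a.
  by rewrite ler_wpM2l ?subr_ge0.
lra.
Qed.

End ctsfun_tools.

Lemma continuous_funmax (R : realType) (T : topologicalType) (u v : T -> R) :
  continuous u -> continuous v -> continuous (fun x => Num.max (u x) (v x)).
Proof. by move=> cu cv x; exact: (@continuous_max R T u v x (cu x) (cv x)). Qed.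

Lemma continuous_funmin (R : realType) (T : topologicalType) (u v : T -> R) :
  continuous u -> continuous v -> continuous (fun x => Num.min (u x) (v x)).
Proof. by move=> cu cv x; exact: (@continuous_min R T u v x (cu x) (cv x)). Qed.

(** * Cutoffs and local modifications of a function *)

Section ctsfun_modification.
Variables (R : realType) (K : topologicalType) (cptK : compact [set: K]).
Variables (H : normedModType R[i]).
Local Notation C := (ctsfun cptK H).
Implicit Types (f g : C) (t s : K) (e h : H).

Definition interpolate u (cu : continuous u) f g : C :=
  f + ctsmul cu (g - f).

Lemma interpolateE (u : K -> R) (cu : continuous u) f g x :
  interpolate cu f g x = (1 - u x)%:C%C *: f x + (u x)%:C%C *: g x.
Proof.
have -> : interpolate cu f g x = f x + (u x)%:C%C *: (g x - f x) by [].
by rewrite rmorphB/= rmorph1 scalerBl scale1r scalerBr addrA addrAC.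
Qed.

Lemma interpolateB (u : K -> R) (cu : continuous u) f g x :
  (interpolate cu f g - f) x = (u x)%:C%C *: (g x - f x).
Proof.
have -> : interpolate cu f g - f = ctsmul cu (g - f) by rewrite /interpolate addrC addKr.
by [].
Qed.

Lemma interpolate_le1 (u : K -> R) (cu : continuous u) f g x :
  (forall x, 0 <= u x <= 1) -> realnorm (f x) <= 1 -> realnorm (g x) <= 1 ->
  realnorm (interpolate cu f g x) <= 1.
Proof. by move=> u01 f1 g1; rewrite interpolateE convex_combination_le. Qed.

(** The cutoff [u] depends only on the distance from [f y] to [f t]: it is 1 up to [r] and 0 from
    [2 * r] on. So wherever [f] is changed, its value was within [2 * r] of [f t]. *)
Lemma local_replace f t h (r : R) : `|f| = 1 -> realnorm h <= 1 -> 0 < r ->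
  exists g, [/\ forall x, realnorm (g x) <= 1,
    forall y, realnorm (f y - f t) <= r -> g y = h &
    `|g - f| <= realnorm (h - f t) + 2 * r].
Proof.
move=> f1 h1 r0.
pose n y := realnorm (f y - f t).
pose u y := Num.max 0 (Num.min 1 (2 - n y / r)).
have cn : continuous n.
  apply: continuous_realnorm => x; apply: cvgB; last exact: cvg_cst.
  exact: cts_fun.
have cu : continuous u.
  apply: continuous_funmax => [x|]; first exact: cvg_cst.
  apply: continuous_funmin => x; first exact: cvg_cst.
  apply: (@cvgB _ R^o); first exact: cvg_cst.
  by apply: (@cvgMr_tmp R); exact: cn.
have u01 x : 0 <= u x <= 1.
  by rewrite /u le_max lexx ge_max ler01 ge_min lexx.
have hC x : realnorm ((ctscst cptK h : C) x) <= 1 by [].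
exists (interpolate cu f (ctscst cptK h)); split.
- by move=> x; apply: interpolate_le1 => //; exact: sphere_le1.
- move=> y ny; rewrite interpolateE.
  have -> : u y = 1.
    have : n y / r <= 1 by rewrite ler_pdivrMr// mul1r.
    move=> nyr; rewrite /u; have /min_idPl -> : 1 <= 2 - n y / r by lra.
    by apply/max_idPr; rewrite ler01.
  by rewrite subrr scale0r scale1r add0r.
- apply: normr_ctsfun_le => [|x].
    by rewrite addr_ge0 ?realnorm_ge0// mulr_ge0 ?ltW.
  rewrite interpolateB realnormZ.
  have /andP[u0 u1] := u01 x; rewrite ger0_norm//.
  have [nr|rn] := leP (n x) (2 * r).
    apply: (@le_trans _ _ (realnorm (h - f x))).
      by rewrite ler_piMl ?realnorm_ge0.
    have -> : h - f x = (h - f t) - (f x - f t) by rewrite opprB addrA addrNK.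
    by rewrite (le_trans (ler_realnormD _ _))// realnormN lerD2l.
  have -> : u x = 0.
    rewrite /u; apply/max_idPl; rewrite ge_min; apply/orP; right.
    by rewrite subr_le0 ler_pdivlMr// ltW.
  by rewrite mul0r addr_ge0 ?realnorm_ge0// mulr_ge0 ?ltW.
Qed.

Hypothesis hausK : hausdorff_space K.

(** Urysohn's lemma, as compact Hausdorff spaces are normal. *)
Lemma separating_function t s : t != s -> exists u : K -> R,
  [/\ continuous u, forall x, 0 <= u x <= 1, u t = 1 & u s = 0].
Proof.
move=> ts; have c1 (x : K) : closed [set x].
  exact/accessible_closed_set1/hausdorff_accessible.
have : uniform_separator [set s] [set t].
  apply: (@normal_separatorP R K).1 => //; first exact: compact_normal.
  by apply/seteqP; split=> // x [/= ->] /eqP; rewrite eq_sym (negPf ts).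
move=> /(@uniform_separatorP K R)[u [cu u01 u0 u1]]; exists u; split=> //.
- by move=> x; have /u01 : range u (u x) by []; rewrite /= in_itv.
- by apply: u1; exists t.
- by apply: u0; exists s.
Qed.

(** Multiply [f] by [1 - u], where [u] is a Urysohn function times [n / Num.max n (realnorm (f x))]
    with [n = realnorm (f t)]. The second factor caps the removed part [u f] at [n] everywhere and
    is 1 at [t]. *)
Lemma kill_at f t s : t != s -> `|f| = 1 -> exists g,
  [/\ forall x, realnorm (g x) <= 1, g t = 0, g s = f s &
      `|f - g| <= realnorm (f t)].
Proof.
move=> ts f1; have [ft0|ft0] := eqVneq (f t) 0.
  exists f; split=> // [x|]; first exact: sphere_le1.
  by rewrite subrr normr0 ft0 realnorm0.
have [v [cv v01 vt vs]] := separating_function ts.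
set n := realnorm (f t); have n0 : 0 < n.
  rewrite lt_neqAle realnorm_ge0 andbT eq_sym; apply: contra_neq ft0.
  exact: realnorm_eq0.
pose m x := Num.max n (realnorm (f x)).
have m0 x : 0 < m x by rewrite lt_max n0.
pose u x := v x * (n / m x).
have cm : continuous m.
  apply: continuous_funmax => [x|]; first exact: cvg_cst.
  by apply: continuous_realnorm; exact: cts_fun.
have cu : continuous u.
  move=> x; apply: (@cvgM R); first exact: cv.
  apply: (@cvgMl_tmp R); apply: (@cvgV R); first by rewrite gt_eqF.
  exact: cm.
have nm x : 0 <= n / m x <= 1.
  by rewrite divr_ge0 ?(ltW n0) ?(ltW (m0 x))// ler_pdivrMr// mul1r le_max lexx.
have u01 x : 0 <= u x <= 1.
  have /andP[v0 v1] := v01 x; have /andP[a0 a1] := nm x.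
  by rewrite mulr_ge0//= mulr_ile1.
have un x : u x * realnorm (f x) <= n.
  have /andP[v0 v1] := v01 x; have /andP[a0 a1] := nm x.
  rewrite /u -mulrA; apply: (@le_trans _ _ (n / m x * realnorm (f x))).
    by rewrite ler_piMl// mulr_ge0 ?realnorm_ge0.
  by rewrite mulrAC ler_pdivrMr// ler_pM2l// le_max lexx orbT.
exists (interpolate cu f 0); split.
- move=> x; apply: interpolate_le1 => //; first exact: sphere_le1.
  by rewrite [X in realnorm X](_ : _ = 0)// realnorm0 ler01.
- rewrite interpolateE [X in _ + _ *: X](_ : _ = 0)// scaler0 addr0.
  by rewrite /u vt mul1r /m maxxx divff ?gt_eqF// subrr scale0r.
- by rewrite interpolateE /u vs mul0r subr0 scale1r scale0r addr0.
- apply: normr_ctsfun_le => [|x]; first exact: realnorm_ge0.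
  rewrite -[f - _]opprB [X in realnorm X](_ : _ = - (interpolate cu f 0 - f) x)//.
  rewrite realnormN interpolateB [X in X - _](_ : _ = 0)// sub0r realnormZ.
  by rewrite realnormN ger0_norm ?un//; case/andP: (u01 x).
Qed.

End ctsfun_modification.

(** * Supporting functionals on C(K, H) *)

Lemma le0_of_le_geometric (R : realType) (x a : R) :
  (forall n, x <= a / 2 ^+ n) -> x <= 0.
Proof.
move=> xa; apply/ler_addgt0Pr => r r0; rewrite add0r.
have [n an] : exists n : nat, a / r < n%:R.
  by exists (Num.truncn (a / r)).+1; rewrite Num.Theory.truncnS_gt.
apply: le_trans (xa n) _; rewrite ler_pdivrMr ?exprn_gt0//.
rewrite -ler_pdivrMl// mulrC (le_trans (ltW an))//.
by rewrite -natrX ler_nat ltnW// ltn_expl.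
Qed.

Section peak_functionals.
Variables (R : realType) (K : topologicalType) (cptK : compact [set: K]).
Hypothesis hausK : hausdorff_space K.
Variables (H : normedModType R[i]) (dot : {dot H for Num.conj}).
Hypothesis normE : forall x : H, `|x| ^+ 2 = dot x x.
Local Notation C := (ctsfun cptK H).
Local Notation "<< x , y >>" := (ip dot x y).
Variables (Y : normedModType R) (Delta : C -> Y).
Hypothesis Dfun : set_fun (@unit_sphere R C) (@unit_sphere R Y) Delta.
Hypothesis Dsurj : set_surj (@unit_sphere R C) (@unit_sphere R Y) Delta.
Hypothesis Diso : isometry_on (@unit_sphere R C) Delta.
Implicit Types (f g k : C) (t s : K) (e h a x : H) (phi : {scalar Y}).

Definition supports t e phi :=
  [/\ forall y, phi y <= `|y|,
      forall f, `|f| = 1 -> f t = e -> phi (Delta f) = 1 &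
      forall f, `|f| = 1 -> f t = - e -> phi (Delta f) = -1].

Lemma exists_supports t e : realnorm e = 1 -> exists phi, supports t e phi.
Proof.
move=> e1; have l_le f : evip dot t e f <= `|f| by exact: evip_le.
have [phi [phi_le phi1 phiN1]] := face_functional Dfun Dsurj Diso l_le.
exists phi; split=> // f f1 ft; [apply: phi1|apply: phiN1] => //.
  by rewrite /= /evip ft ipxx// e1 expr1n.
by rewrite /= /evip ft ipNl ipxx// e1 expr1n.
Qed.

Variables (t : K) (e : H) (phi : {scalar Y}).
Hypothesis e1 : realnorm e = 1.
Hypothesis phiP : supports t e phi.

Lemma supports_lip f g : `|f| = 1 -> `|g| = 1 ->
  phi (Delta f) - phi (Delta g) <= `|f - g|.
Proof.
move=> f1 g1; rewrite -linearB/= -(Delta_dist Diso)//.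
by case: phiP.
Qed.

Lemma near_face f h (r : R) : `|f| = 1 -> realnorm h = 1 -> 0 < r ->
  exists g, [/\ `|g| = 1, g t = h & `|g - f| <= realnorm (h - f t) + r].
Proof.
move=> f1 h1 r0; have r20 : 0 < r / 2 by rewrite divr_gt0.
have [|g [g1 gt gf]] := @local_replace _ _ cptK _ f t h (r / 2) f1 _ r20.
  by rewrite h1.
have gth : g t = h by apply: gt; rewrite subrr realnorm0 ltW.
exists g; split=> //; first by apply: (sphere_norm g1 (s := t)); rewrite gth.
by rewrite (le_trans gf)// mulrC divfK// pnatr_eq0.
Qed.

(** [phi] composed with [Delta] is 1-Lipschitz on the sphere, and up to any [r > 0] the face where
    [g t = e] is no farther from [f] than [e] is from [f t]. *)
Lemma supports_ge f : `|f| = 1 -> 1 - realnorm (f t - e) <= phi (Delta f).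
Proof.
move=> f1; apply/ler_addgt0Pr => r r0.
have [g [g1 gt gf]] := near_face f1 e1 r0.
have := supports_lip g1 f1; have [_ /(_ _ g1 gt) -> _] := phiP.
by move: gf; rewrite -realnormN opprB; lra.
Qed.

Lemma supports_le f : `|f| = 1 -> phi (Delta f) <= realnorm (f t + e) - 1.
Proof.
move=> f1; apply/ler_addgt0Pr => r r0.
have Ne1 : realnorm (- e) = 1 by rewrite realnormN.
have [g [g1 gt gf]] := near_face f1 Ne1 r0.
have := supports_lip f1 g1; have [_ _ /(_ _ g1 gt) ->] := phiP.
by move: gf; rewrite -opprD realnormN distrC [e + _]addrC; lra.
Qed.

(** Both [1 - realnorm (f t - e)] and [realnorm (f t + e) - 1] agree with the inner product to first
    order in [f t]; [realnormD_le_ip] for [e] and [- e] bounds the remainder. *)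
Lemma supports_quadratic f : `|f| = 1 ->
  `|phi (Delta f) - << f t, e >>| <= realnorm (f t) ^+ 2 / 2.
Proof.
move=> f1; rewrite ler_norml; have := supports_ge f1; have := supports_le f1.
have := realnormD_le_ip normE (f t) e1.
have Ne1 : realnorm (- e) = 1 by rewrite realnormN.
have := realnormD_le_ip normE (f t) Ne1; rewrite ipNr.
move=> A1 A2 A3 A4; apply/andP; split; lra.
Qed.

(** By [supports_le] the vector [f t + e] has norm at least 2, and strict convexity concludes. Thus
    [phi] detects membership in the face. *)
Lemma supports_eq1 f : `|f| = 1 -> phi (Delta f) = 1 -> f t = e.
Proof.
move=> f1 phi1; apply: (@realnorm_strictly_convex _ _ _ normE _ _ 1).
- exact: sphere_le1.
- by rewrite e1.
- by have := supports_le f1; rewrite phi1; lra.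
Qed.

End peak_functionals.

(** * Midpoints inside a face and decay of the quadratic error *)

Section two_points.
Variables (R : realType) (K : topologicalType) (cptK : compact [set: K]).
Hypothesis hausK : hausdorff_space K.
Variables (H : normedModType R[i]) (dot : {dot H for Num.conj}).
Hypothesis normE : forall x : H, `|x| ^+ 2 = dot x x.
Local Notation C := (ctsfun cptK H).
Local Notation "<< x , y >>" := (ip dot x y).
Variables (Y : normedModType R) (Delta : C -> Y).
Hypothesis Dfun : set_fun (@unit_sphere R C) (@unit_sphere R Y) Delta.
Hypothesis Dsurj : set_surj (@unit_sphere R C) (@unit_sphere R Y) Delta.
Hypothesis Diso : isometry_on (@unit_sphere R C) Delta.
Implicit Types (f g k : C) (t s : K) (e h a x : H) (phi : {scalar Y}).

(** A functional supporting the face of [s] is 1 at the midpoint of [Delta f] and [Delta g], which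
    is therefore a unit vector [Delta k] with [k] in the face. As [k] is a metric midpoint of [f]
    and [g], uniqueness of midpoints in [H] fixes it wherever their distance is attained. *)
Lemma midpoint_in_face f g s x : realnorm x = 1 -> `|f| = 1 -> `|g| = 1 ->
  f s = x -> g s = x -> exists k,
  [/\ `|k| = 1, k s = x, Delta k = 2^-1 *: (Delta f + Delta g) &
    forall t, realnorm (f t - g t) = `|f - g| -> k t = 2^-1%:C%C *: (f t + g t)].
Proof.
move=> x1 f1 g1 fs gs.
have [phi phiP] := exists_supports normE Dfun Dsurj Diso s x1.
have [phi_le phi1 _] := phiP.
pose y := 2^-1 *: (Delta f + Delta g).
have phiy : phi y = 1.
  by rewrite /y linearZ linearD/= !phi1//; field.
have y1 : `|y| = 1.
  apply/eqP; rewrite eq_le -{2}phiy phi_le andbT /y normZ_ge0 ?invr_ge0//.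
  rewrite ler_pdivrMl// mulr1 (le_trans (ler_normD _ _))//.
  by rewrite !(Delta_norm Dfun).
have [k k1 ky] := Delta_onto Dsurj y1.
exists k; split=> //; first by apply: (supports_eq1 normE Diso x1 phiP); rewrite // ky.
move=> t fgt.
have dist (a b : C) : `|a| = 1 -> y - Delta a = 2^-1 *: (Delta b - Delta a) ->
    `|b| = 1 -> `|k - a| <= `|b - a| / 2.
  move=> a1 ya b1; rewrite -(Delta_dist Diso)// ky ya normZ_ge0 ?invr_ge0//.
  by rewrite (Delta_dist Diso)// mulrC.
have half (z : Y) : z = 2^-1 *: (z + z).
  by rewrite -{2 3}[z]scale1r -scalerDl scalerA mulVf ?scale1r// pnatr_eq0.
apply: (realnorm_midpoint normE).
  rewrite fgt distrC; apply: le_trans (ler_realnorm (k - f) t) _.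
  apply: dist => //; rewrite {1}[Delta f]half /y -scalerBr; congr (_ *: _).
  by rewrite opprD addrACA subrr add0r.
rewrite fgt; apply: le_trans (ler_realnorm (k - g) t) _.
apply: dist => //; rewrite {1}[Delta g]half /y -scalerBr; congr (_ *: _).
by rewrite opprD addrACA subrr addr0.
Qed.

Variables (t : K) (e : H) (phi : {scalar Y}).
Hypothesis e1 : realnorm e = 1.
Hypothesis phiP : supports Delta t e phi.

(** Take the midpoint of [f] and the function [g] of [kill_at]: the distance of [f] and [g] is
    attained at [t], and [phi (Delta g) = 0] by the quadratic bound at [g t = 0]. *)
Lemma halve_in_face f s x : s != t -> realnorm x = 1 -> `|f| = 1 -> f s = x ->
  exists k, [/\ `|k| = 1, k s = x, k t = 2^-1%:C%C *: f t &
                phi (Delta k) = phi (Delta f) / 2].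
Proof.
move=> st x1 f1 fs.
have ts : t != s by rewrite eq_sym.
have [g [gle1 gt gs fg]] := kill_at hausK ts f1.
have g1 : `|g| = 1 by apply: (sphere_norm gle1 (s := s)); rewrite gs fs.
have [k [k1 ks kE kt]] := midpoint_in_face x1 f1 g1 fs (etrans gs fs).
exists k; split=> //.
  rewrite kt ?gt ?addr0// subr0; apply/eqP; rewrite eq_le fg andbT.
  by rewrite -[f t]subr0 -gt; exact: (ler_realnorm (f - g) t).
have := supports_quadratic normE Diso e1 phiP g1.
rewrite gt realnorm0 expr0n/= mul0r normr_le0 -{1}[0 : H](scale0r 0).
rewrite -[0](rmorph0 (real_complex R)) ipZl mul0r subr0 => /eqP phig.
by rewrite kE linearZ linearD/= phig addr0 mulrC.
Qed.

(* The error is at most quadratic in [f t], but doubling along [halve_in_face]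
   shows that it scales linearly. *)
Lemma supports_eq_of_peak f s : s != t -> `|f| = 1 -> realnorm (f s) = 1 ->
  phi (Delta f) = << f t, e >>.
Proof.
move=> st f1 fs; apply/eqP; rewrite -subr_eq0 -normr_le0.
have bound n : forall f', `|f'| = 1 -> f' s = f s ->
    `|phi (Delta f') - << f' t, e >>| <= realnorm (f' t) ^+ 2 / 2 / 2 ^+ n.
  elim: n => [|n IH] f' f'1 f's.
    by rewrite expr0 divr1; exact: supports_quadratic.
  have [k [k1 ks kt kphi]] := halve_in_face st fs f'1 f's.
  have := IH k k1 ks; rewrite kt kphi ipZl realnormZ.
  rewrite [`|2^-1|]ger0_norm ?invr_ge0// [_ / 2 - _]addrC [_ / 2]mulrC addrC.
  rewrite -mulrBr normrM [`|2^-1|]ger0_norm ?invr_ge0// ler_pdivrMl// => /le_trans.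
  apply; rewrite exprMn [2 ^+ n.+1]exprS le_eqVlt; apply/orP; left; apply/eqP.
  by field; rewrite expf_neq0// pnatr_eq0.
by apply: le0_of_le_geometric (fun n => bound n _ f1 erefl).
Qed.

End two_points.

(** * Spaces with at least two points *)

Section several_points.
Variables (R : realType) (K : topologicalType) (cptK : compact [set: K]).
Hypothesis hausK : hausdorff_space K.
Variables (H : normedModType R[i]) (dot : {dot H for Num.conj}).
Hypothesis normE : forall x : H, `|x| ^+ 2 = dot x x.
Local Notation C := (ctsfun cptK H).
Local Notation "<< x , y >>" := (ip dot x y).
Variables (Y : normedModType R) (Delta : C -> Y).
Hypothesis Dfun : set_fun (@unit_sphere R C) (@unit_sphere R Y) Delta.
Hypothesis Dsurj : set_surj (@unit_sphere R C) (@unit_sphere R Y) Delta.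
Hypothesis Diso : isometry_on (@unit_sphere R C) Delta.
Implicit Types (f g k : C).
Variables (t s0 : K) (e : H) (phi : {scalar Y}).
Hypothesis e1 : realnorm e = 1.
Hypothesis phiP : supports Delta t e phi.
Hypothesis ts0 : s0 != t.

Let supports_eq_of_peak := @supports_eq_of_peak R K cptK hausK H dot normE Y
  Delta Dfun Dsurj Diso t e phi e1 phiP.

(** Flatten [f] to the constant [f t] near [t]. The new function is close to [f] and attains its
    norm at a second point, where [supports_eq_of_peak] applies. *)
Lemma supports_eq_nonisolated f : ~ open [set t] -> `|f| = 1 ->
  realnorm (f t) = 1 -> phi (Delta f) = << f t, e >>.
Proof.
move=> nopen f1 ft; apply/eqP; rewrite -subr_eq0 -normr_le0.
apply/ler_addgt0Pr => r r0; rewrite add0r.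
have r20 : 0 < r / 2 by rewrite divr_gt0.
have [|g [g1 gt gf]] := @local_replace _ _ cptK _ f t (f t) (r / 2) f1 _ r20.
  by rewrite ft.
have [s st fs] : exists2 s, s != t & realnorm (f s - f t) <= r / 2.
  have tn : \forall y \near t, realnorm (f y - f t) < r / 2.
    have cn : continuous (fun y => realnorm (f y - f t)).
      apply: continuous_realnorm => x; apply: cvgB; last exact: cvg_cst.
      exact: cts_fun.
    have /cvgrPdist_lt/(_ _ r20) := cn t; apply: filterS => y /=.
    by rewrite subrr realnorm0 sub0r normrN ger0_norm ?realnorm_ge0.
  apply: contrapT => no; apply: nopen; rewrite openE => _ ->.
  apply: filterS tn => y yr; apply: contrapT => yt; apply: no.
  by exists y; [exact/eqP|exact: ltW].
have gtE : g t = f t by apply: gt; rewrite subrr realnorm0 ltW.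
have gs1 : realnorm (g s) = 1 by rewrite gt.
have gn : `|g| = 1 by exact: (sphere_norm g1 gs1).
rewrite -gtE -(supports_eq_of_peak st gn gs1).
move: gf; rewrite subrr realnorm0 add0r mulrC divfK ?pnatr_eq0// => gf.
rewrite ler_norml.
have := supports_lip Diso phiP f1 gn; have := supports_lip Diso phiP gn f1.
by rewrite [`|f - g|]distrC => a b; apply/andP; split; lra.
Qed.

(** Off [t], add and subtract the same multiple of [e] until one of the two functions first found of
    norm 1 there; then [f] is the only metric midpoint of the pair that agrees with it at [t]. *)
Lemma split_isolated f : open [set t] -> `|f| = 1 -> realnorm (f t) = 1 ->
  exists f1 f2, [/\ `|f1| = 1 /\ `|f2| = 1, f1 t = f t /\ f2 t = f t,
    exists2 s, s != t & realnorm (f1 s) = 1 &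
    phi (Delta f) = (phi (Delta f1) + phi (Delta f2)) / 2].
Proof.
move=> opent fn ft.
(* Continuous since [t] is isolated and points are closed. *)
pose u (x : K) : R := if x == t then 0 else 1.
have cu : continuous u.
  move=> x; have [xt|xt] := eqVneq x t.
    apply: (@near_cst_continuous K R (u x) u x).
    rewrite xt; have : nbhs t [set t] by exact: open_nbhs_nbhs.
    by apply: filterS => y ->.
  apply: (@near_cst_continuous K R (u x) u x).
  have : nbhs x (~` [set t]).
    apply: open_nbhs_nbhs; split; last exact/eqP.
    exact/closed_openC/accessible_closed_set1/hausdorff_accessible.
  by apply: filterS => y /eqP yt; rewrite /u (negPf yt) (negPf xt).
pose p := ctsmul cu f; pose z := ctsmul cu (ctscst cptK e).
have pE x : x != t -> p x = f x.
  by move=> xt; rewrite [LHS](_ : _ = (u x)%:C%C *: f x)// /u (negPf xt) scale1r.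
have pt : p t = 0.
  by rewrite [LHS](_ : _ = (u t)%:C%C *: f t)// /u eqxx scale0r.
have zE x : x != t -> z x = e.
  by move=> xt; rewrite [LHS](_ : _ = (u x)%:C%C *: e)// /u (negPf xt) scale1r.
have zt : z t = 0.
  by rewrite [LHS](_ : _ = (u t)%:C%C *: e)// /u eqxx scale0r.
have addE (g h : C) x : (g + h) x = g x + h x by [].
have scaleE (r : R) (g : C) x : (r *: g) x = r%:C%C *: g x by [].
(* The intermediate value theorem on [[0, 2]] makes the larger norm equal to 1; at [r = 2] the value
   at [s0] already has norm at least 2 - 1. *)
pose N (r : R) := Num.max `|p + r *: z| `|p - r *: z|.
have cN : continuous N.
  have cz (w : C) : continuous (fun r : R => `|p + r *: w|).
    move=> r; apply: cvg_norm; apply: cvgD; first exact: cvg_cst.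
    by apply: cvgZr_tmp; exact: cvg_id.
  apply: continuous_funmax; first exact: cz.
  by under eq_fun do rewrite -scalerN; exact: cz.
have [r r0 Nr] : exists2 r, 0 <= r & N r = 1.
  have z1 : realnorm (z s0) = 1 by rewrite zE.
  have N0 : N 0 <= 1.
    rewrite /N scale0r subr0 addr0 maxxx; apply: normr_ctsfun_le => // x.
    have [->|xt] := eqVneq x t; first by rewrite pt realnorm0.
    by rewrite pE// sphere_le1.
  have N2 : 1 <= N 2.
    rewrite /N le_max; apply/orP; left.
    apply: le_trans (ler_realnorm _ s0); rewrite addE pE// scaleE zE//.
    have := ler_realnormD (f s0 + 2%:C%C *: e) (- f s0).
    rewrite addrAC subrr add0r realnormN realnormZ e1 mulr1 ger0_norm//.
    have := sphere_le1 s0 fn; lra.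
  have /(@IVT R N 0 2 1 (ler0n _ _) (continuous_subspaceT cN)) :
      Num.min (N 0) (N 2) <= 1 <= Num.max (N 0) (N 2).
    by rewrite ge_min N0/= le_max N2 orbT.
  move=> [r r02 Nr].
  exists r => //; move: r02; rewrite in_itv/=; case/andP => //.
pose f1 := f + r *: z; pose f2 := f - r *: z.
have f1t : f1 t = f t by rewrite /f1 addE scaleE zt scaler0 addr0.
have f2t : f2 t = f t by rewrite /f2 -scaleNr addE scaleE zt scaler0 addr0.
have nle (g : C) (v : R) : (forall x, x != t -> g x = (p + v *: z) x) -> g t = f t ->
    `|p + v *: z| <= 1 -> `|g| = 1.
  move=> gE gt pv; apply: (sphere_norm (s := t)); last by rewrite gt.
  move=> x; have [->|xt] := eqVneq x t; first by rewrite gt ft.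
  by rewrite gE//; apply: le_trans (ler_realnorm _ _) pv.
have [p1 p2] : `|p + r *: z| <= 1 /\ `|p - r *: z| <= 1.
  by rewrite -Nr /N !le_max !lexx orbT.
have f11 : `|f1| = 1.
  by apply: (nle _ r) => // x xt; rewrite /f1 !addE pE.
have f21 : `|f2| = 1.
  apply: (nle _ (- r)); rewrite ?scaleNr// => x xt.
  by rewrite /f2 !addE pE.
have [k [k1 kt kD kE]] := midpoint_in_face normE Dfun Dsurj Diso ft f11 f21 f1t f2t.
(* Off [t] the difference [f1 - f2] has constant norm [2 * r], its supremum norm, so [k] is
   determined at every such point. *)
have kf : k = f.
  apply/ctsfunP => x; have [->//|xt] := eqVneq x t.
  have f12 : f1 - f2 = (2 * r) *: z.
    by rewrite /f1 /f2 opprB [_ - f]addrC addrACA subrr add0r -scalerDl mulr2n mulrDl mul1r.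
  have f12x : realnorm (f1 x - f2 x) = 2 * r.
    rewrite [f1 x - f2 x](_ : _ = (f1 - f2) x)// f12 scaleE zE// realnormZ e1.
    by rewrite mulr1 ger0_norm// mulr_ge0.
  rewrite kE.
    rewrite /f1 /f2 -scaleNr !addE !scaleE addrACA -scalerDl -rmorphD/= subrr.
    rewrite scale0r addr0 -{1 2}[f x]scale1r -scalerDl scalerA.
    rewrite -[1 + 1](rmorph_nat (real_complex R) 2).
    by rewrite -rmorphM/= mulVf ?pnatr_eq0// rmorph1 scale1r.
  rewrite f12x; apply/eqP; rewrite eq_le; apply/andP; split.
    by rewrite -f12x; exact: (ler_realnorm (f1 - f2) x).
  rewrite f12.
  rewrite normZ_ge0 ?mulr_ge0// ler_piMr ?mulr_ge0//.
  apply: normr_ctsfun_le => // y.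
  by have [->|yt] := eqVneq y t; rewrite ?zt ?realnorm0// zE// e1.
have phik : phi (Delta f) = (phi (Delta f1) + phi (Delta f2)) / 2.
  by rewrite -kf kD linearZ linearD/= mulrC.
have peak (g : C) (v : R) : (forall x, x != t -> g x = (p + v *: z) x) ->
    `|p + v *: z| = 1 -> exists2 s, s != t & realnorm (g s) = 1.
  move=> gE /norm_attained[s]; have [->|st] := eqVneq s t.
    by rewrite addE scaleE pt zt scaler0 addr0 realnorm0 => /eqP; rewrite eq_sym oner_eq0.
  by move=> ps; exists s; rewrite ?gE.
have [pr|pr] : `|p + r *: z| = 1 \/ `|p - r *: z| = 1.
  by move: Nr; rewrite /N; case: leP; [right|left].
  exists f1, f2; split=> //; apply: (peak _ r) => // x xt.
  by rewrite /f1 !addE pE.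
exists f2, f1; split=> //; last by rewrite addrC.
apply: (peak _ (- r)); rewrite ?scaleNr// => x xt.
by rewrite /f2 !addE pE.
Qed.

(** In the isolated case one half of the splitting has no error, so the error at [f] is half that of
    the other half, which has the same value at [t]. Errors being uniformly bounded, iteration makes
    them vanish. *)
Lemma supports_eq f : `|f| = 1 -> phi (Delta f) = << f t, e >>.
Proof.
move=> f1; have [[s [st fs]]|nopeak] :=
  pselect (exists s, s != t /\ realnorm (f s) = 1).
  exact: supports_eq_of_peak fs.
have peak_t g : `|g| = 1 -> realnorm (g t) = 1 \/
    exists2 s, s != t & realnorm (g s) = 1.
  move=> /norm_attained[s gs]; have [<-|st] := eqVneq s t; first by left.
  by right; exists s.
have ft : realnorm (f t) = 1.
  by have [//|[s st fs]] := peak_t _ f1; case: nopeak; exists s.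
have [opent|] := pselect (open [set t]); last first.
  by move=> /supports_eq_nonisolated; apply.
apply/eqP; rewrite -subr_eq0 -normr_le0.
apply: (@le0_of_le_geometric _ _ 2) => n.
elim: n f f1 ft {nopeak} => [|n IH] f f1 ft.
  rewrite expr0 divr1.
  have := supports_quadratic normE Diso e1 phiP f1; rewrite ft => /le_trans; apply.
  by rewrite expr1n; lra.
have [g1 [g2 [[g11 g21] [g1t g2t] [s st g1s] ->]]] := split_isolated opent f1 ft.
have := IH g2 g21; rewrite g2t => /(_ ft).
rewrite (supports_eq_of_peak st g11 g1s) g1t => bnd.
have -> : (<< f t, e >> + phi (Delta g2)) / 2 - << f t, e >> =
          (phi (Delta g2) - << f t, e >>) / 2 by field.
rewrite normrM [`|2^-1|]ger0_norm ?invr_ge0// exprS invfM mulrA -ler_pdivlMr ?invr_gt0//.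
apply: le_trans bnd _; rewrite le_eqVlt; apply/orP; left; apply/eqP.
by field; rewrite expf_neq0// pnatr_eq0.
Qed.

End several_points.

(** * Planes satisfying the rhombus law *)

Section day.
Variables (R : realType) (V : normedModType R).
Hypothesis rhombus : forall u v : V, `|u| = 1 -> `|v| = 1 ->
  `|u + v| ^+ 2 + `|u - v| ^+ 2 = 4.
Variables p q : V.
Hypotheses (p1 : `|p| = 1) (q1 : `|q| = 1) (pq : `|p + q| = `|p - q|).

Let E (x : R) : V := cos x *: p + sin x *: q.

Let lcD (a b c d : R) : (a *: p + b *: q) + (c *: p + d *: q) =
  (a + c) *: p + (b + d) *: q.
Proof. by rewrite addrACA -!scalerDl. Qed.

Let lcZ (r a b : R) : r *: (a *: p + b *: q) = (r * a) *: p + (r * b) *: q.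
Proof. by rewrite scalerDr !scalerA. Qed.

(** The quarter turn is carried along because [bisect] needs both chords. *)
Let good x := `|E x| = 1 /\ `|E (x + pi / 2)| = 1.

Let EDpi x : E (x + pi / 2 + pi / 2) = - E x.
Proof. by rewrite /E !(cosDpihalf, sinDpihalf) opprD -!scaleNr. Qed.

Let goodS x : good x -> good (x + pi / 2).
Proof. by case=> ? ?; split=> //; rewrite EDpi normrN. Qed.

(** The sum and difference of [E (m + d)] and [E (m - d)] are [2 * cos d] times [E m] and
    [2 * sin d] times [E (m + pi / 2)]. *)
Let chord (m d : R) : `|E (m - d)| = 1 -> `|E (m + d)| = 1 ->
  cos d ^+ 2 * `|E m| ^+ 2 + sin d ^+ 2 * `|E (m + pi / 2)| ^+ 2 = 1.
Proof.
move=> E1 E2; have := rhombus E2 E1.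
have -> : E (m + d) + E (m - d) = (2 * cos d) *: E m.
  rewrite /E lcD lcZ cosD cosB sinD sinB.
  by congr (_ *: _ + _ *: _); ring.
have -> : E (m + d) - E (m - d) = (2 * sin d) *: E (m + pi / 2).
  rewrite /E -scaleN1r !lcZ lcD cosDpihalf sinDpihalf cosD cosB sinD sinB.
  by congr (_ *: _ + _ *: _); ring.
have sqZ (r : R) (v : V) : `|r *: v| ^+ 2 = r ^+ 2 * `|v| ^+ 2.
  by rewrite normrZ exprMn real_normK// num_real.
by rewrite !sqZ => h; apply: (@mulfI _ 4); rewrite ?pnatr_eq0// mulr1 -[RHS]h; ring.
Qed.

(* The rhombus law for the two chords, and for the chords turned by a right
   angle, gives two linear equations for [`|E m| ^+ 2] and
   [`|E (m + pi / 2)| ^+ 2]. *)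
Let bisect (m d : R) : 0 <= d <= pi / 8 -> good (m - d) -> good (m + d) ->
  good m.
Proof.
move=> /andP[d0 dpi] [a1 a2] [b1 b2].
have := chord a1 b1; have := @chord (m + pi / 2) d.
rewrite (addrAC m (pi / 2) (- d)) (addrAC m (pi / 2) d) EDpi normrN => /(_ a2 b2).
have := cos2Dsin2 d.
have c0 : 0 < cos d ^+ 2 - sin d ^+ 2.
  rewrite !expr2 -cosD; apply: cos_gt0_pihalf.
  have := pi_gt0 R => pi0; apply/andP; split; lra.
set c := cos d ^+ 2 in c0 *; set s := sin d ^+ 2 in c0 *.
have sq1 (x : R) : 0 <= x -> x ^+ 2 = 1 -> x = 1.
  by move=> x0 /eqP; rewrite sqrp_eq1// => /eqP.
move=> cs h1 h2.
have AB : `|E m| ^+ 2 = `|E (m + pi / 2)| ^+ 2.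
  apply/eqP; rewrite -subr_eq0 -(mulrI_eq0 _ (lregP (lt0r_neq0 c0))).
  rewrite mulrBr !mulrBl; apply/eqP; lra.
move: h2; rewrite -AB -mulrDl cs mul1r => A1.
by split; apply: sq1 => //; rewrite -AB.
Qed.

Let good0 : good 0.
Proof.
rewrite /good add0r /E cos0 sin0 cos_pihalf sin_pihalf.
by rewrite !scale1r !scale0r addr0 add0r.
Qed.

(** The rhombus law and [pq] give [p + q] and [p - q] norm the square root of 2. *)
Let good_pi4 : good (pi / 4).
Proof.
pose r : R := cos (pi / 4).
have h : pi / 4 + pi / 4 = pi / 2 :> R by field.
have r0 : 0 < r.
  by apply: cos_gt0_pihalf; have := pi_gt0 R => pi0; apply/andP; split; lra.
have sr : sin (pi / 4) = r.
  by rewrite /r -[RHS]cosN -cosBpihalf; congr cos; lra.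
have r2 : 2 * r ^+ 2 = 1.
  by have := cos2Dsin2 (pi / 4 : R); rewrite sr -/r; lra.
have n2 : r * `|p + q| = 1.
  apply/eqP; rewrite -(@sqrp_eq1 _ (_ * _)) ?mulr_ge0 ?(ltW r0)// exprMn.
  have := rhombus p1 q1; rewrite -pq => h2; apply/eqP; nra.
split.
  by rewrite /E sr -/r -scalerDr normZ_ge0// ltW.
rewrite /E cosDpihalf sinDpihalf sr -/r scaleNr addrC -scalerBr normZ_ge0 ?(ltW r0)//.
by rewrite distrC -pq.
Qed.

(** Repeated bisection; [L <= pi / 4] keeps the half-width within the [pi / 8] required by
    [bisect]. *)
Let dyadic n : forall (a b L : R), good a -> good b -> 0 <= b - a <= L ->
  L <= pi / 4 -> forall x, a <= x <= b ->
  exists2 y, good y & `|x - y| <= L / 2 ^+ n.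
Proof.
elim: n => [|n IH] a b L ga gb /andP[ab0 abL] L4 x /andP[ax xb].
  by exists a => //; rewrite expr0 divr1 ger0_norm; lra.
have gm : good ((a + b) / 2).
  apply: (@bisect _ ((b - a) / 2)); first by apply/andP; split; lra.
    by rewrite (_ : _ - _ = a)//; field.
  by rewrite (_ : _ + _ = b)//; field.
have [xm|mx] := leP x ((a + b) / 2).
  have [|||y gy xy] := IH a ((a + b) / 2) (L / 2) ga gm _ _ x.
  - by apply/andP; split; lra.
  - lra.
  - by rewrite ax.
  by exists y => //; rewrite exprS invfM mulrA.
have [|||y gy xy] := IH ((a + b) / 2) b (L / 2) gm gb _ _ x.
- by apply/andP; split; lra.
- lra.
- by rewrite ltW.
by exists y => //; rewrite exprS invfM mulrA.
Qed.

Let norm_between (a b : R) : good a -> good b -> 0 <= b - a <= pi / 4 ->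
  forall x, a <= x <= b -> `|E x| = 1.
Proof.
move=> ga gb ab x xab; apply/eqP; rewrite -subr_eq0 -normr_le0.
apply/ler_addgt0Pr => r r0; rewrite add0r.
have cE : continuous (fun y => `|E y|).
  move=> y; apply: cvg_norm; apply: cvgD; apply: cvgZr_tmp.
    exact: continuous_cos.
  exact: continuous_sin.
have /cvgrPdist_lt/(_ _ r0)/nbhs_ballP[d /= d0 dP] := cE x.
have [n nd] : exists n, (pi / 4) / 2 ^+ n < d.
  apply: contrapT => no; have : d <= 0.
    apply: (@le0_of_le_geometric _ _ (pi / 4)) => n.
    by rewrite leNgt; apply/negP => nd; apply: no; exists n.
  by rewrite leNgt d0.
have [y [Ey _] xy] := dyadic n ga gb ab (lexx _) xab.
have := dP y; rewrite /= Ey => /(_ _)/ltW; apply.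
by rewrite -ball_normE; exact: le_lt_trans xy nd.
Qed.

Let norm_pi (x : R) : 0 <= x <= pi -> `|E x| = 1.
Proof.
move=> /andP[x0 xpi].
have := pi_gt0 R => pi0.
have g2 : good (pi / 2) by have := goodS good0; rewrite add0r.
have g3 : good (3 * (pi / 4)).
  by rewrite (_ : 3 * (pi / 4) = pi / 4 + pi / 2); [exact: goodS|field].
have g4 : good pi by rewrite (_ : pi = pi / 2 + pi / 2 :> R); [exact: goodS|field].
have [x1|x1] := leP x (pi / 4).
  by apply: (norm_between good0 good_pi4); apply/andP; split; lra.
have [x2|x2] := leP x (pi / 2).
  by apply: (norm_between good_pi4 g2); apply/andP; split; lra.
have [x3|x3] := leP x (3 * (pi / 4)).
  by apply: (norm_between g2 g3); apply/andP; split; lra.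
by apply: (norm_between g3 g4); apply/andP; split; lra.
Qed.

(** Polar coordinates with angle [acos (x / r)]. A change of sign reduces to [0 <= y], so angles in
    [[0, pi]] suffice. *)
Lemma rhombus_plane_euclidean (x y : R) :
  `|x *: p + y *: q| ^+ 2 = x ^+ 2 + y ^+ 2.
Proof.
wlog y0 : x y / 0 <= y.
  move=> wlg; have [y0|/ltW y0] := leP 0 y; first exact: wlg.
  by rewrite -normrN opprD -!scaleNr wlg ?oppr_ge0// !sqrrN.
have [xy0|xy0] := eqVneq (x ^+ 2 + y ^+ 2) 0.
  have /eqP : x ^+ 2 == 0 by have := sqr_ge0 x; have := sqr_ge0 y; rewrite eq_le; lra.
  have /eqP : y ^+ 2 == 0 by have := sqr_ge0 x; have := sqr_ge0 y; rewrite eq_le; lra.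
  move=> /eqP; rewrite sqrf_eq0 => /eqP -> /eqP; rewrite sqrf_eq0 => /eqP ->.
  by rewrite !scale0r addr0 normr0 expr0n addr0.
have s0 : 0 < x ^+ 2 + y ^+ 2 by rewrite lt_neqAle eq_sym xy0 addr_ge0 ?sqr_ge0.
pose r := Num.sqrt (x ^+ 2 + y ^+ 2).
have r0 : 0 < r by rewrite sqrtr_gt0.
have r2 : r ^+ 2 = x ^+ 2 + y ^+ 2 by rewrite sqr_sqrtr ?ltW.
have xr : -1 <= x / r <= 1.
  by rewrite ler_pdivrMr// ler_pdivlMr//; apply/andP; split; nra.
have cx : cos (acos (x / r)) = x / r by rewrite acosK// in_itv.
have sx : sin (acos (x / r)) = y / r.
  rewrite sin_acos// -[RHS]ger0_norm ?divr_ge0 ?(ltW r0)// -sqrtr_sqr.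
  by congr Num.sqrt; rewrite !expr_div_n r2; field.
have -> : x *: p + y *: q = r *: E (acos (x / r)).
  by rewrite /E lcZ cx sx !(mulrC r) !divfK ?gt_eqF.
by rewrite normZ_ge0 ?(ltW r0)// norm_pi ?mulr1// acos_ge0// acos_lepi.
Qed.

End day.

(** * One-point spaces *)

Section one_point.
Variables (R : realType) (K : topologicalType) (cptK : compact [set: K]).
Variables (H : normedModType R[i]) (dot : {dot H for Num.conj}).
Hypothesis normE : forall x : H, `|x| ^+ 2 = dot x x.
Local Notation C := (ctsfun cptK H).
Local Notation "<< x , y >>" := (ip dot x y).
Variables (Y : normedModType R) (Delta : C -> Y).
Hypothesis Dfun : set_fun (@unit_sphere R C) (@unit_sphere R Y) Delta.
Hypothesis Dsurj : set_surj (@unit_sphere R C) (@unit_sphere R Y) Delta.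
Hypothesis Diso : isometry_on (@unit_sphere R C) Delta.
Implicit Types (f g k : C).
Variable t : K.
Hypothesis onlyt : forall s, s = t.

Let norm1 f : `|f| = realnorm (f t).
Proof.
apply/eqP; rewrite eq_le ler_realnorm andbT.
by apply: normr_ctsfun_le => [|x]; [exact: realnorm_ge0|rewrite (onlyt x)].
Qed.

Let ext1 f g : f t = g t -> f = g.
Proof. by move=> fg; apply/ctsfunP => x; rewrite (onlyt x). Qed.

(** The preimage of [- Delta g] is at distance 2 from [g], and by strict convexity only [- g] is. *)
Let DeltaN g : `|g| = 1 -> Delta (- g) = - Delta g.
Proof.
move=> g1.
have : `|- Delta g| = 1 by rewrite normrN (Delta_norm Dfun).
move=> /(Delta_onto Dsurj)[k k1 kE]; rewrite -kE; congr Delta; apply: ext1.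
have : `|k - g| = 2.
  rewrite -(Delta_dist Diso)// kE -opprD normrN -mulr2n normrMn.
  by rewrite (Delta_norm Dfun).
rewrite norm1 => kg; apply/esym/(@realnorm_strictly_convex _ _ _ normE _ _ 1).
- by rewrite -norm1 k1.
- by rewrite -norm1 normrN g1.
- by rewrite mulr1 -kg.
Qed.

Let DeltaD f g : `|f| = 1 -> `|g| = 1 -> `|Delta f + Delta g| = `|f + g|.
Proof.
move=> f1 g1; rewrite -[Delta g]opprK -DeltaN// (Delta_dist Diso) ?opprK//.
by rewrite normrN.
Qed.

(** The parallelogram law of [H] carried over: differences by isometry, sums by oddness. *)
Let sphere_rhombus (u v : Y) : `|u| = 1 -> `|v| = 1 ->
  `|u + v| ^+ 2 + `|u - v| ^+ 2 = 4.
Proof.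
move=> /(Delta_onto Dsurj)[f f1 <-] /(Delta_onto Dsurj)[g g1 <-].
rewrite DeltaD// (Delta_dist Diso)// !norm1.
rewrite [X in X ^+ 2 + _](_ : _ = realnorm (f t + g t))//.
rewrite [X in _ + X ^+ 2](_ : _ = realnorm (f t - g t))//.
by rewrite (parallelogram normE) -!norm1 f1 g1; ring.
Qed.

Variables (e : H) (phi : {scalar Y}).
Hypothesis e1 : realnorm e = 1.
Hypothesis phiP : supports Delta t e phi.

(** Write [f t] as [c e + d b] with [b] a unit vector orthogonal to [e]. In the Euclidean plane of
    their images, [Delta f] turns out to be the same combination, and [phi] takes the values 1 and 0
    on the two images. *)
Lemma supports_eq_one_point f : `|f| = 1 -> phi (Delta f) = << f t, e >>.
Proof.
move=> f1; have [phi_le phi1 phiN1] := phiP.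
have ft1 : realnorm (f t) = 1 by rewrite -norm1.
set c := << f t, e >>.
pose h := f t - c%:C%C *: e; pose d := realnorm h.
have he : << h, e >> = 0.
  by rewrite /h ipDl ipNl ipZl ipxx// e1 expr1n mulr1 subrr.
have cd : c ^+ 2 + d ^+ 2 = 1.
  rewrite /d -(ipxx normE) {2}/h (ipDr dot) (ipNr dot) [<< h, _ *: _ >>](ipC dot).
  rewrite (ipZl dot) (ipC dot e) he mulr0 subr0 /h (ipDl dot) (ipNl dot) (ipZl dot).
  by rewrite (ipxx normE) ft1 [<< e, f t >>](ipC dot) -/c; ring.
have [d0|d0] := eqVneq d 0.
  have fce : f t = c%:C%C *: e.
    by apply/eqP; rewrite -subr_eq0; apply/eqP/realnorm_eq0.
  have /eqP : c ^+ 2 = 1 by rewrite -cd d0 expr0n addr0.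
  rewrite sqrf_eq1 => /orP[] /eqP cE; rewrite cE.
    by apply: phi1 => //; rewrite fce cE rmorph1 scale1r.
  by apply: phiN1 => //; rewrite fce cE rmorphN rmorph1 scaleN1r.
have dpos : 0 < d by rewrite lt_neqAle eq_sym d0 realnorm_ge0.
pose b := d^-1%:C%C *: h.
have b1 : realnorm b = 1.
  by rewrite /b realnormZ ger0_norm ?invr_ge0 ?ltW// mulVf.
have be : << b, e >> = 0 by rewrite /b ipZl he mulr0.
have ft : f t = c%:C%C *: e + d%:C%C *: b.
  by rewrite /b scalerA -rmorphM/= divff// rmorph1 scale1r addrC subrK.
pose E := ctscst cptK e; pose B := ctscst cptK b.
have E1 : `|E| = 1 by rewrite norm1.
have B1 : `|B| = 1 by rewrite norm1.
have EB : `|Delta E + Delta B| = `|Delta E - Delta B|.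
  rewrite DeltaD// (Delta_dist Diso)// !norm1; apply/eqP.
  rewrite -(@eqrXn2 _ 2) ?realnorm_ge0//.
  rewrite [X in X ^+ 2 == _](_ : _ = realnorm (e + b))//.
  rewrite [X in _ == X ^+ 2](_ : _ = realnorm (e - b))//.
  by rewrite (sqr_realnormD normE) (sqr_realnormB normE) ipC be mulr0 subr0 addr0.
have planeE := rhombus_plane_euclidean sphere_rhombus
  (Delta_norm Dfun E1) (Delta_norm Dfun B1) EB.
have phiE : phi (Delta E) = 1 by exact: phi1.
(* Testing [phi] on [Delta E + s *: Delta B] gives [1 + s ^+ 2] at most its own square root, so
   [s = 0]. *)
have phiB : phi (Delta B) = 0.
  set s := phi (Delta B).
  have := planeE 1 s; have := phi_le (1 *: Delta E + s *: Delta B).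
  rewrite linearD !linearZ/= phiE -/s mulr1 expr1n => le1 eq1.
  have := normr_ge0 (1 *: Delta E + s *: Delta B); set n := `|_| in le1 eq1 *.
  by move=> n0; apply/eqP; rewrite -sqrf_eq0 eq_le sqr_ge0 andbT; nra.
pose y := c *: Delta E + d *: Delta B.
have y1 : `|y| = 1.
  by apply/eqP; rewrite -(@sqrp_eq1 _ `|y|)// planeE cd.
have [z z1 zy] := Delta_onto Dsurj y1.
have zt1 : realnorm (z t) = 1 by rewrite -norm1.
(* The distance from [z] to [E] is computed in the Euclidean plane of [Y] and compared with its
   expansion in [H]. *)
have ze : << z t, e >> = c.
  have := planeE (c - 1) d.
  rewrite scalerBl scale1r addrAC -/y -zy (Delta_dist Diso)// norm1.
  rewrite [X in X ^+ 2 = _](_ : _ = realnorm (z t - e))//.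
  by rewrite (sqr_realnormB normE) zt1 e1; nra.
have zb : << z t, b >> = d.
  have := planeE c (d - 1).
  rewrite scalerBl scale1r addrA -/y -zy (Delta_dist Diso)// norm1.
  rewrite [X in X ^+ 2 = _](_ : _ = realnorm (z t - b))//.
  by rewrite (sqr_realnormB normE) zt1 b1; nra.
have zf : z = f.
  apply: ext1; apply: (ip1_eq normE) => //; first by rewrite zt1.
  have zZ (r : R) (x : H) : << z t, r%:C%C *: x >> = r * << z t, x >>.
    by rewrite ipC ipZl ipC.
  by rewrite ft ipDr (zZ c e) (zZ d b) ze zb -!expr2.
by rewrite -zf zy linearD !linearZ/= phiE phiB mulr1 mulr0 addr0.
Qed.

End one_point.

(** * Assembling the functionals over all points and directions *)

Theorem theorem5p6 (R : realType)
    (K : topologicalType) (cptK : compact [set: K]) (hausK : hausdorff_space K)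
    (H : completeNormedModType R[i]) (dot : {dot H for Num.conj})
    (normE : forall x : H, `|x| ^+ 2 = dot x x) :
  mazur_ulam_property (ctsfun cptK H).
Proof.
move=> Y Delta Dfun Dsurj Diso.
pose I := {te : K * H | realnorm te.2 = 1}.
pose l (i : I) : {scalar ctsfun cptK H} := evip dot (sval i).1 (sval i).2.
have phi_ex (i : I) : exists phi : {scalar Y}, forall f : ctsfun cptK H,
    `|f| = 1 -> phi (Delta f) = l i f.
  case: i => [[t e] e1]; rewrite /l /=.
  have [phi phiP] := exists_supports normE Dfun Dsurj Diso t e1.
  exists phi => f f1.
  have [[s st]|onlyt] := pselect (exists s, s != t).
    exact: (supports_eq hausK normE Dfun Dsurj Diso e1 phiP st).
  apply: (supports_eq_one_point normE Dfun Dsurj Diso _ e1 phiP) => // s.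
  by apply: contrapT => /eqP st; apply: onlyt; exists s.
have [phi phiE] := choice phi_ex.
apply: (sphere_linear_extension Dfun Dsurj _ phiE) => f f1.
have [t ft] := norm_attained f1.
(* At a point where [f] attains its norm, the direction [f t] itself gives the value 1. *)
by exists (exist _ (t, f t) ft); rewrite /l /= /evip ipxx// ft expr1n.
Qed.
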